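(* Let $n \geq 2$ and let $\|\cdot\|$ be a norm on $\mathbb{R}^n$ with unit ball $B$, such that the boundary $\partial B$ is a $C^1$ manifold and the Gauss map $g : \partial B \to S^{n-1}$ cannot decrease Hausdorff dimension, that is, $\dim_{\mathrm{H}} g(E) \geq \dim_{\mathrm{H}} E$ for all $E \subseteq \partial B$. Then for all non-empty sets $F \subseteq \mathbb{R}^n$, $$\dim_{\mathrm{A}} D^{\|\cdot\|}(F) \geq \min\{\dim_{\mathrm{A}} F-\theta, \, 1\},$$ where $\theta = \theta(\dim_{\mathrm{A}} F, n, 1)$.
   Context: The distance set of $F\subseteq\mathbb{R}^n$ with respect to the norm $\|\cdot\|$ is $D^{\|\cdot\|}(F) = \{\|x-y\| : x,y \in F\}$. The Gauss map sends a point of $\partial B$ to the outward unit normal vector there. The Assouad dimension $\dim_{\mathrm{A}} F$ of $F\subseteq \mathbb{R}^n$ is the infimum of $\alpha \geq 0$ for which there is $C>0$ such that, for all $x \in F$ and $0<r<R$, the set $F \cap B(x,R)$ may be covered by fewer than $C(R/r)^\alpha$ sets of diameter $r$. $G(n,m)$ is the Grassmannian of $m$-dimensional linear subspaces of $\mathbb{R}^n$ (with its usual metric), $\pi_V$ is orthogonal projection (with respect to the Euclidean inner product) of $\mathbb{R}^n$ onto $V\in G(n,m)$, and $\dim_{\mathrm{H}}$ is Hausdorff dimension. For integers $n>m\geq 1$ and $s \in [0,n]$, $$\theta(s,n,m) := \sup_{F} \dim_{\mathrm{H}} \{ V \in G(n,m) : \dim_{\mathrm{A}} \pi_V (F) <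 \min\{\dim_{\mathrm{A}} F, m\}\},$$ where the supremum is taken over all sets $F \subseteq \mathbb{R}^n$ with $\dim_{\mathrm{A}} F = s$ (the empty set having Hausdorff dimension $0$). *)

(* Defs.v *)
From HB Require Import structures.
From mathcomp Require Import all_boot all_order all_algebra.
From mathcomp Require Import all_classical all_reals all_analysis.

Set Implicit Arguments.
Unset Strict Implicit.
Unset Printing Implicit Defensive.

Import Order.TTheory GRing.Theory Num.Theory.
Import numFieldNormedType.Exports.

Local Open Scope classical_set_scope.
Local Open Scope ring_scope.

(* The metric is an explicit argument d, because the canonical metric of
   'rV[R]_n is the one of the sup norm. *)
Section Dimensions.
Context {R : realType} {T : Type} (d : T -> T -> R).

(* Adjoining 0 only matters for the empty set, whose diameter is thus 0. *)
Definition diameter (A : set T) : \bar R :=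
  ereal_sup (0%E |` [set (d p.1 p.2)%:E | p in A `*` A]).

Definition diameter_pow (s : R) (A : set T) : \bar R :=
  if A == set0 then 0%E else poweR (diameter A) s.

Definition delta_cover (delta : R) (E : set T) (U : nat -> set T) : Prop :=
  (forall i, (diameter (U i) <= delta%:E)%E) /\ E `<=` \bigcup_i U i.

Definition hausdorff_premeasure (s delta : R) (E : set T) : \bar R :=
  ereal_inf [set (\sum_(0 <= i <oo) diameter_pow s (U i))%E
            | U in delta_cover delta E].

(* This premeasure is nonincreasing in delta, so this supremum is its limit as
   delta tends to 0. *)
Definition hausdorff_measure (s : R) (E : set T) : \bar R :=
  ereal_sup [set hausdorff_premeasure s delta E | delta in [set e : R | 0 < e]].

Definition hausdorff_dim (E : set T) : \bar R :=
  ereal_inf [set s%:E | s in [set s : R | 0 <= s /\ hausdorff_measure s E = 0%E]].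

Definition closed_ball_of (x : T) (rho : R) : set T := [set y | d x y <= rho].

(* As usual in covering numbers, "sets of diameter r" are sets of diameter at
   most r. *)
Definition assouad_exponent (F : set T) (alpha : R) : Prop :=
  exists2 C : R, 0 < C &
    forall (x : T) (r rho : R), F x -> 0 < r -> r < rho ->
      exists (k : nat) (U : 'I_k -> set T),
        [/\ k%:R < C * (rho / r) `^ alpha,
            (forall i, (diameter (U i) <= r%:E)%E) &
            F `&` closed_ball_of x rho `<=` \bigcup_i U i].

Definition assouad_dim (F : set T) : \bar R :=
  ereal_inf [set alpha%:E
            | alpha in [set a : R | 0 <= a /\ assouad_exponent F a]].

End Dimensions.

Section Euclidean.
Context {R : realType} {n : nat}.
Implicit Types (x y u v : 'rV[R]_n) (V W : {vspace 'rV[R]_n}).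

Definition dotp u v : R := \sum_i u 0 i * v 0 i.
Definition enorm u : R := Num.sqrt (dotp u u).
Definition eucl_dist x y : R := enorm (x - y).

Definition orth_proj V x : 'rV[R]_n :=
  xget 0 [set y | y \in V /\ forall v, v \in V -> dotp (x - y) v = 0].

(* The operator norm of the difference of the two projections. *)
Definition grass_dist V W : R :=
  sup [set enorm (orth_proj V x - orth_proj W x) | x in [set x | enorm x <= 1]].

Definition grassmannian (m : nat) : set {vspace 'rV[R]_n} :=
  [set V | \dim V = m].

Definition exceptional_set (m : nat) (F : set 'rV[R]_n) :
    set {vspace 'rV[R]_n} :=
  [set V | grassmannian m V /\
    (assouad_dim eucl_dist (orth_proj V @` F)
       < Order.min (assouad_dim eucl_dist F) (m%:R)%:E)%E].

End Euclidean.

Definition theta {R : realType} (s : \bar R) (n m : nat) : \bar R :=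
  ereal_sup [set hausdorff_dim grass_dist (exceptional_set m F)
            | F in [set F : set 'rV[R]_n | assouad_dim eucl_dist F = s]].

Section NormsAndGaussMap.
Context {R : realType} {n : nat}.
Implicit Types (N : 'rV[R]_n -> R) (A B M U : set 'rV[R]_n) (x v nu : 'rV[R]_n).

Definition is_norm N : Prop :=
  [/\ (forall x, N x = 0 -> x = 0),
      (forall (a : R) x, N (a *: x) = `|a| * N x) &
      (forall x v, N (x + v) <= N x + N v)].

Definition unit_ball N : set 'rV[R]_n := [set x | N x <= 1].

Definition boundary A : set 'rV[R]_n := closure A `\` interior A.

(* Continuity of each directional derivative is continuity of the
   differential, since the dimension is finite. *)
Definition C1_on U (f : 'rV[R]_n -> R) : Prop :=
  forall x, U x ->
    differentiable f x /\
    forall v, {for x, continuous (fun y => 'd f y v)}.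

(* Embedded C^1 submanifolds of codimension 1, by local defining functions. *)
Definition C1_hypersurface M : Prop :=
  forall x, M x -> exists (U : set 'rV[R]_n) (f : 'rV[R]_n -> R),
    [/\ open U, U x, C1_on U f,
        (forall y, U y -> exists v, 'd f y v != 0) &
        M `&` U = [set y | U y /\ f y = 0]].

Definition tangent_vector M x v : Prop :=
  exists gamma : R -> 'rV[R]_n,
    [/\ gamma 0 = x, (\forall t \near (0 : R), M (gamma t)) &
        is_derive (0 : R) (1 : R) gamma v].

Definition outward_unit_normal B x nu : Prop :=
  [/\ enorm nu = 1,
      (forall v, tangent_vector (boundary B) x v -> dotp nu v = 0) &
      (\forall t \near (0 : R)^'+, ~ B (x + t *: nu))].

(* Meaningful at the points of a C^1 boundary, where the outward unit normal
   exists and is unique. *)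
Definition gauss_map B x : 'rV[R]_n :=
  xget 0 [set nu | outward_unit_normal B x nu].

Definition distance_set N (F : set 'rV[R]_n) : set R :=
  [set N (p.1 - p.2) | p in F `*` F].

End NormsAndGaussMap.

Definition rdist {R : realType} (a b : R) : R := `|a - b|.

(* Main.v *)
Require Import Defs.
From HB Require Import structures.
From mathcomp Require Import all_boot all_order all_algebra.
From mathcomp Require Import all_classical all_reals all_analysis.
From mathcomp Require Import ring lra.

Set Implicit Arguments.
Unset Strict Implicit.
Unset Printing Implicit Defensive.

Import Order.TTheory GRing.Theory Num.Theory.
Import numFieldNormedType.Exports.

Local Open Scope classical_set_scope.
Local Open Scope ring_scope.

(** Let s be the Assouad dimension of F, and suppose that the distance set of F
    has an Assouad exponent a < min (s - theta, 1). The contradiction comes from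
    rescaled limits of F, on which distances from far away look like orthogonal
    projections.

    A limit W of enlargements of F has positive s-dimensional Hausdorff content
    (exists_thick_tangent). Around almost every point of W there are arbitrarily
    small balls whose content is comparable to the s-th power of the radius. The
    enlargements of W in these balls are described by countably many yes-no
    questions, namely which small balls with rational data they meet. Null
    sets are a sigma-ideal, so the questions can be answered one at a time in
    such a way that, at each stage, a set of points of positive content sees the
    answers given so far at arbitrarily small scales (sees_branch). The complete
    list of answers describes one set P, of Assouad dimension s. A limit E of
    enlargements of the sets of points that see the successive stages has
    positive content as well; near each pair x, y of points of E, at a suitable
    scale, F contains a copy of the pair and a much smaller copy of any finite
    part of P next to y (common_microtangent, tangents_with_copies). The point of
    this construction is that P is the same for all y.

    A norm is a convex function, so where it is differentiable it is strictly
    differentiable (gradient_strict). The distances from x to the tiny copy of P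
    near y are therefore an almost affine image of the projection of P to the
    line spanned by the Gauss image of the direction of y - x. This projection
    thus inherits the exponent a (projection_approximable), and as a < min (s, 1)
    the line is exceptional for P. Since P has dimension s, all these lines
    together have Hausdorff dimension at most theta. A set of unit vectors is
    null if the set of lines that they span is (hcontent_lines), and the Gauss map
    does not decrease dimension, so the directions from x to the points of E have
    dimension at most theta too. The distances from x to the points of E are limits of rescaled
    distances of F, hence have exponent a. In polar coordinates, E has dimension
    at most theta + a < s (hcontent_polar), although its s-dimensional content is
    positive. *)

(** * Hausdorff content *)

Section HContent.
Context {R : realType} {T : pointedType} (d : T -> T -> R) (q : R).
Hypothesis q0 : 0 < q.
Implicit Types (A B U : set T) (r : R).

Definition diam_le r U := forall x y, U x -> U y -> d x y <= r.

(** The q-th power of the diameter, except that only positive radii are admitted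
    as bounds: for q > 0 this gives the value 0 to the empty set, and an infinite
    value to unbounded sets. *)
Definition gauge U : \bar R :=
  ereal_inf [set (r `^ q)%:E | r in [set r | 0 < r /\ diam_le r U]].

(** The Hausdorff content of dimension q. The outer measure extension expects a
    semiring of sets; the sigma-algebra generated by all sets makes every cover
    admissible. *)
Definition hcontent A : \bar R :=
  mu_ext (T := g_sigma_algebraType (@setT (set T))) gauge A.

Let all_measurable (A : set (g_sigma_algebraType (@setT (set T)))) :
  measurable A.
Proof. exact: sub_sigma_algebra. Qed.

Lemma gauge_ge0 U : (0 <= gauge U)%E.
Proof. by apply: le_ereal_inf_tmp => _ [r _ <-]; rewrite lee_fin powR_ge0. Qed.

Lemma gauge_le r U : 0 < r -> diam_le r U -> (gauge U <= (r `^ q)%:E)%E.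
Proof. by move=> r0 Ur; apply: ereal_inf_lbound; exists r. Qed.

Lemma le0_powR (x : \bar R) :
  (forall r, 0 < r -> (x <= (r `^ q)%:E)%E) -> (x <= 0)%E.
Proof.
move=> h; apply/lee_addgt0Pr => e e0; rewrite add0e.
have := h (e `^ q^-1) (powR_gt0 _ e0).
by rewrite -powRrM mulVf ?gt_eqF// powRr1// ltW.
Qed.

Lemma gauge0 : gauge set0 = 0%E.
Proof.
apply/eqP; rewrite eq_le gauge_ge0 andbT.
by apply: le0_powR => r r0; apply: gauge_le.
Qed.

Lemma hcontent_ge0 A : (0 <= hcontent A)%E.
Proof. exact: (@mu_ext_ge0 _ (g_sigma_algebraType (@setT (set T))) R gauge gauge_ge0 A). Qed.

Lemma le_hcontent A B : A `<=` B -> (hcontent A <= hcontent B)%E.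
Proof. exact: (@le_mu_ext _ (g_sigma_algebraType (@setT (set T))) R gauge). Qed.

Lemma hcontent0 : hcontent set0 = 0%E.
Proof. exact: (@mu_ext0 _ (g_sigma_algebraType (@setT (set T))) R gauge gauge0 gauge_ge0). Qed.

Lemma hcontent_bigcup (A : nat -> set T) :
  (hcontent (\bigcup_i A i) <= \sum_(0 <= i <oo) hcontent (A i))%E.
Proof. exact: (@mu_ext_sigma_subadditive _ (g_sigma_algebraType (@setT (set T))) R gauge gauge_ge0). Qed.

Lemma hcontent_null_bigcup (A : nat -> set T) :
  (forall i, hcontent (A i) = 0%E) -> hcontent (\bigcup_i A i) = 0%E.
Proof.
move=> A0; apply/eqP; rewrite eq_le hcontent_ge0 andbT.
by apply: le_trans (hcontent_bigcup _) _; rewrite eseries0.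
Qed.

Lemma hcontent_setU A B : (hcontent (A `|` B) <= hcontent A + hcontent B)%E.
Proof.
rewrite -bigcup2E; apply: le_trans (hcontent_bigcup _) _.
rewrite (@nneseries_split _ _ 0 2); last by move=> *; exact: hcontent_ge0.
rewrite add0n !big_nat_recr//= big_nil add0e eseries0 ?adde0//.
by move=> [|[|i]]//= _ _; rewrite hcontent0.
Qed.

Lemma hcontent_gauge A : (hcontent A <= gauge A)%E.
Proof.
rewrite -[gauge A]adde0 -gauge0; apply: ereal_inf_lbound.
exists (bigcup2 A set0); first by split => // x Ax; exists 0%N.
rewrite (@nneseries_split _ _ 0 2); last by move=> *; exact: gauge_ge0.
rewrite add0n !big_nat_recr//= big_nil add0e eseries0 ?adde0//.
by move=> [|[|i]]//= _ _; rewrite gauge0.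
Qed.

Lemma hcontent_le r A : 0 < r -> diam_le r A -> (hcontent A <= (r `^ q)%:E)%E.
Proof. by move=> r0 Ar; apply: le_trans (hcontent_gauge A) (gauge_le r0 Ar). Qed.

Lemma hcontent_seq (I : Type) (s : seq I) (b : I -> \bar R) (U : I -> set T) A :
  (forall i, (hcontent (U i) <= b i)%E) ->
  A `<=` (fun x => has (fun i => `[< U i x >]) s) ->
  (hcontent A <= \sum_(i <- s) b i)%E.
Proof.
move=> Ub; elim: s A => [|i s IH] A As.
  by rewrite big_nil -hcontent0; apply: le_hcontent => x /As.
rewrite big_cons.
pose B x := has (fun i => `[< U i x >]) s.
apply: (@le_trans _ _ (hcontent (U i `|` B))).
  by apply: le_hcontent => x /As /= /orP[/asboolP|] ?; [left|right].
by apply: le_trans (hcontent_setU _ _) _; apply: leeD => //; apply: IH => x.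
Qed.

Lemma hcontent_cover A (x : \bar R) : (hcontent A < x)%E ->
  exists (U : nat -> set T) (r : nat -> R),
    [/\ forall i, 0 < r i, forall i, diam_le (r i) (U i),
        A `<=` \bigcup_i U i & (\sum_(0 <= i <oo) (r i `^ q)%:E < x)%E].
Proof.
move=> /ereal_inf_lt[_ [U [_ AU] <-] Ux].
set S := (\sum_(k <oo) _)%E in Ux.
have S0 : (0 <= S)%E by apply: nneseries_ge0 => *; exact: gauge_ge0.
have Sfin : S \is a fin_num.
  by rewrite ge0_fin_numE// (lt_le_trans Ux)// leey.
have [e e0 eS] : exists2 e : R, 0 < e & (S + e%:E < x)%E.
  case: x Ux => [x| |] //.
    rewrite -(fineK Sfin) lte_fin => Sx; exists ((x - fine S) / 2).
      by rewrite divr_gt0// subr_gt0.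
    by rewrite -EFinD lte_fin; lra.
  by move=> _; exists 1 => //; rewrite -(fineK Sfin) -EFinD ltry.
  by rewrite ltNge leNye.
have /choice[r rP] : forall i : nat, exists r, [/\ 0 < r, diam_le r (U i) &
    ((r `^ q)%:E <= gauge (U i) + (e / (2 ^ i.+1)%:R)%:E)%E].
  move=> i; have Gfin : gauge (U i) \is a fin_num.
    rewrite ge0_fin_numE ?gauge_ge0// ltey; apply/eqP => Uoo.
    move: Sfin; rewrite /S (eseries_pinfty _ _ Uoo)// => n _.
    by rewrite -ltNye; apply: lt_le_trans (gauge_ge0 _); exact: ltNy0.
  have ei : 0 < e / (2 ^ i.+1)%:R by rewrite divr_gt0// ltr0n expn_gt0.
  have [_ [r [r0 rU] <-] /ltW re] := lb_ereal_inf_adherent ei Gfin.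
  by exists r.
exists U, r; split => //; [by move=> i; case: (rP i)..|].
apply: le_lt_trans eS.
apply: le_trans (epsilon_trick xpredT _ (ltW e0)); last first.
  by move=> *; exact: gauge_ge0.
apply: lee_nneseries => [i _ _|i _]; first by rewrite lee_fin powR_ge0.
by case: (rP i).
Qed.

End HContent.

Arguments hcontent_ge0 {R T d q} A.
Arguments le_hcontent {R T d q} [A B] _.
Arguments hcontent0 {R T d q} _.
Arguments hcontent_bigcup {R T d q} A.
Arguments hcontent_null_bigcup {R T d q} [A] _.
Arguments hcontent_setU {R T d q} _ A B.
Arguments hcontent_le {R T d q} _ [r A] _ _.
Arguments hcontent_seq {R T d q} _ [I] s b U [A] _ _.
Arguments hcontent_cover {R T d q} [A x] _.

(** * Hausdorff measure and small covers *)

Lemma nneseries_term (R : realType) (a : nat -> R) (i : nat) (M : R) :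
  (forall k, 0 <= a k) -> (\sum_(0 <= k <oo) (a k)%:E <= M%:E)%E -> a i <= M.
Proof.
move=> a0 aM; rewrite -lee_fin; apply: le_trans aM.
rewrite (@nneseries_split _ _ 0 i.+1); last by move=> *; rewrite lee_fin.
rewrite add0n big_nat_recr//= -addeA addeCA leeDl// adde_ge0//.
  by apply: sume_ge0 => *; rewrite lee_fin.
by apply: nneseries_ge0 => *; rewrite lee_fin.
Qed.

Section HausdorffCovers.
Context {R : realType} {T : Type} (d : T -> T -> R).
Implicit Types (U E : set T) (p q r : R).

(** For q > 0 this says that E is null for the Hausdorff measure of dimension q:
    a small total cost forces all the radii to be small. *)
Definition small_covers q E := forall e : R, 0 < e ->
  exists (U : nat -> set T) (r : nat -> R),
    [/\ forall i, 0 < r i, forall i x y, U i x -> U i y -> d x y <= r i,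
        E `<=` \bigcup_i U i & (\sum_(0 <= i <oo) (r i `^ q)%:E <= e%:E)%E].

Lemma diameter_ge0 U : (0 <= diameter d U)%E.
Proof. by apply: ereal_sup_ubound; left. Qed.

Lemma diameter_ge U x y : U x -> U y -> ((d x y)%:E <= diameter d U)%E.
Proof. by move=> Ux Uy; apply: ereal_sup_ubound; right; exists (x, y). Qed.

Lemma diameter_le U r : 0 <= r -> (forall x y, U x -> U y -> d x y <= r) ->
  (diameter d U <= r%:E)%E.
Proof.
move=> r0 Ur; apply: ge_ereal_sup => _ [->|[[x y] /= [Ux Uy] <-]].
  by rewrite lee_fin.
by rewrite lee_fin Ur.
Qed.

Lemma diameter_pow_ge0 q U : (0 <= diameter_pow d q U)%E.
Proof. by rewrite /diameter_pow; case: ifP => // _; exact: poweR_ge0. Qed.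

(** On sets of diameter at most 1, raising the exponent from p to q decreases the
    cost. The radii are chosen so that their q-th powers exceed the p-th powers of
    the diameters by a summable error, which makes them positive. *)
Lemma small_covers_of_hausdorff p q E : 0 <= p -> p < q ->
  hausdorff_measure d p E = 0%E -> small_covers q E.
Proof.
move=> p0 pq HE e e0.
have : (hausdorff_premeasure d p 1 E < e%:E)%E.
  apply: (@le_lt_trans _ _ 0%E); last by rewrite lte_fin.
  by rewrite -HE; apply: ereal_sup_ubound; exists 1 => //=; exact: ltr01.
move=> /ereal_inf_lt[_ [U [U1 EU] <-] Ue].
set S := (\sum_(0 <= i <oo) _)%E in Ue.
have S0 : (0 <= S)%E by apply: nneseries_ge0 => *; exact: diameter_pow_ge0.
have Sfin : S \is a fin_num.
  by rewrite ge0_fin_numE// (lt_trans Ue)// ltry.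
have Ufin i : diameter d (U i) \is a fin_num.
  by rewrite ge0_fin_numE ?diameter_ge0// (le_lt_trans (U1 i)) ?ltry.
have Dfin i : diameter_pow d p (U i) \is a fin_num.
  by rewrite /diameter_pow; case: ifP => // _; rewrite -(fineK (Ufin i)).
pose D i := fine (diameter_pow d p (U i)).
have D0 i : 0 <= D i by rewrite fine_ge0// diameter_pow_ge0.
pose f := e - fine S; have f0 : 0 < f.
  by rewrite subr_gt0 -lte_fin fineK.
pose c i := D i + f / (2 ^ i.+1)%:R.
have c0 i : 0 < c i by rewrite ltr_wpDl// divr_gt0// ltr0n expn_gt0.
have q0 : 0 < q by exact: le_lt_trans pq.
have rE i : (c i `^ q^-1) `^ q = c i.
  by rewrite -powRrM mulVf ?gt_eqF// powRr1// ltW.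
exists U, (fun i => c i `^ q^-1); split => [i|i x y Ux Uy|//|].
- exact: powR_gt0.
- apply: (@le_trans _ _ (fine (diameter d (U i)))).
    by rewrite -lee_fin fineK// diameter_ge.
  set t := fine _.
  have t0 : 0 <= t by rewrite fine_ge0// diameter_ge0.
  have t1 : t <= 1 by rewrite -lee_fin fineK.
  rewrite leNgt; apply/negP => /(gt0_ltr_powR q0) h.
  have : (c i `^ q^-1) `^ q < t `^ q by apply: h; rewrite ?nnegrE// powR_ge0.
  apply/negP; rewrite -leNgt rE /c.
  have -> : D i = t `^ p.
    rewrite /D /diameter_pow; case: ifPn => [/eqP U0|_].
      by move: Ux; rewrite U0.
    by rewrite -(fineK (Ufin i)).
  rewrite ler_wpDr// ?divr_ge0// ?(ltW f0)//.
  have [->|tn] := eqVneq t 0; first by rewrite powR0 ?gt_eqF// powR_ge0.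
  by rewrite ger_powR ?t1 ?lt_neqAle ?t0 ?andbT 1?eq_sym ?tn// ltW.
- have -> : e%:E = (S + f%:E)%E.
    by rewrite -{1}(fineK Sfin) -EFinD /f addrC subrK.
  apply: le_trans (epsilon_trick xpredT _ (ltW f0)); last first.
    by move=> *; exact: diameter_pow_ge0.
  apply: lee_nneseries => [i _ _|i _]; first by rewrite lee_fin powR_ge0.
  by rewrite rE /c EFinD /D fineK.
Qed.

Lemma hausdorff_of_small_covers q E : 0 < q ->
  small_covers q E -> hausdorff_measure d q E = 0%E.
Proof.
move=> q0 cE; apply/eqP; rewrite eq_le; apply/andP; split; last first.
  apply: le_trans (ereal_sup_ubound _); last by exists 1; [exact: ltr01|].
  by apply: le_ereal_inf_tmp => _ [U _ <-]; apply: nneseries_ge0 => *;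
    exact: diameter_pow_ge0.
apply: ge_ereal_sup => _ [t /= t0 <-].
apply/lee_addgt0Pr => e e0; rewrite add0e.
have [|U [r [r0 Ur EU re]]] := cE (Num.min e (t `^ q)).
  by rewrite lt_min e0 powR_gt0.
have rt i : r i <= t.
  have := nneseries_term i (fun k => powR_ge0 (r k) q) re.
  rewrite le_min => /andP[_ rt]; rewrite leNgt; apply/negP => /(gt0_ltr_powR q0).
  by rewrite !nnegrE => /(_ (ltW t0) (ltW (r0 i))); rewrite ltNge rt.
have Dr i : (diameter d (U i) <= (r i)%:E)%E.
  by apply: diameter_le (Ur i); exact: ltW.
apply: (@le_trans _ _ (\sum_(0 <= i <oo) diameter_pow d q (U i))%E).
  apply: ereal_inf_lbound; exists U => //; split => // i.
  by apply: le_trans (Dr i) _; rewrite lee_fin.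
apply: (@le_trans _ _ (Num.min e (t `^ q))%:E); last first.
  by rewrite lee_fin ge_min lexx.
apply: le_trans re; apply: lee_nneseries => [i _ _|i _].
  exact: diameter_pow_ge0.
rewrite /diameter_pow; case: ifP => _; first by rewrite lee_fin powR_ge0.
rewrite -poweR_EFin; apply: gt0_ler_poweR => //.
- exact: ltW.
- by rewrite in_itv/= diameter_ge0 leey.
- by rewrite in_itv/= lee_fin ltW//= leey.
Qed.

End HausdorffCovers.

(** * The Euclidean norm *)

Section EuclideanNorm.
Context {R : realType} {n : nat}.
Implicit Types (x y z u v : 'rV[R]_n) (a r : R).

Lemma dotpC u v : dotp u v = dotp v u.
Proof. by apply: eq_bigr => i _; rewrite mulrC. Qed.

Lemma dotpDl u v w : dotp (u + v) w = dotp u w + dotp v w.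
Proof. by rewrite -big_split; apply: eq_bigr => i _; rewrite mxE mulrDl. Qed.

Lemma dotpZl a u w : dotp (a *: u) w = a * dotp u w.
Proof. by rewrite mulr_sumr; apply: eq_bigr => i _; rewrite mxE mulrA. Qed.

Lemma dotpNl u w : dotp (- u) w = - dotp u w.
Proof. by rewrite -scaleN1r dotpZl mulN1r. Qed.

Lemma dotpBl u v w : dotp (u - v) w = dotp u w - dotp v w.
Proof. by rewrite dotpDl dotpNl. Qed.

Lemma dotpZr a u w : dotp u (a *: w) = a * dotp u w.
Proof. by rewrite dotpC dotpZl dotpC. Qed.

Lemma dotpBr u v w : dotp w (u - v) = dotp w u - dotp w v.
Proof. by rewrite dotpC dotpBl !(dotpC w). Qed.

Lemma dotp0l u : dotp 0 u = 0.
Proof. by rewrite -(scale0r 0) dotpZl mul0r. Qed.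

Lemma dotp_ge0 u : 0 <= dotp u u.
Proof. by apply: sumr_ge0 => i _; rewrite -expr2 sqr_ge0. Qed.

Lemma dotp_eq0 u : dotp u u = 0 -> u = 0.
Proof.
move=> /eqP; rewrite psumr_eq0 => [/allP h|i _]; last by rewrite -expr2 sqr_ge0.
apply/rowP => i; rewrite mxE; apply/eqP.
by have /= := h i (mem_index_enum _); rewrite mulf_eq0 orbb.
Qed.

Lemma enorm_ge0 u : 0 <= enorm u.
Proof. exact: sqrtr_ge0. Qed.

Lemma enorm_sqr u : enorm u ^+ 2 = dotp u u.
Proof. by rewrite sqr_sqrtr// dotp_ge0. Qed.

Lemma enorm_eq0 u : enorm u = 0 -> u = 0.
Proof. by move=> u0; apply: dotp_eq0; rewrite -enorm_sqr u0 expr0n. Qed.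

Lemma enormZ a u : enorm (a *: u) = `|a| * enorm u.
Proof.
by rewrite /enorm dotpZl dotpZr mulrA sqrtrM -?expr2 ?sqr_ge0// sqrtr_sqr.
Qed.

Lemma enorm0 : enorm (0 : 'rV[R]_n) = 0.
Proof. by rewrite -(scale0r 0) enormZ normr0 mul0r. Qed.

Lemma enormN u : enorm (- u) = enorm u.
Proof. by rewrite -scaleN1r enormZ normrN1 mul1r. Qed.

Lemma enormB u v : enorm (u - v) = enorm (v - u).
Proof. by rewrite -opprB enormN. Qed.

Lemma enorm_gt0 u : u != 0 -> 0 < enorm u.
Proof.
by move=> u0; rewrite lt_neqAle enorm_ge0 andbT eq_sym; apply: contraNN u0 =>
  /eqP/enorm_eq0/eqP.
Qed.

Lemma dotp_le u v : dotp u v <= enorm u * enorm v.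
Proof.
have [->|u0] := eqVneq u 0; first by rewrite dotp0l mulr_ge0// enorm_ge0.
have [->|v0] := eqVneq v 0.
  by rewrite dotpC dotp0l mulr_ge0// enorm_ge0.
have pu := enorm_gt0 u0; have pv := enorm_gt0 v0.
have := dotp_ge0 (enorm v *: u - enorm u *: v).
rewrite dotpBl !dotpBr !dotpZl !dotpZr (dotpC v u) -!enorm_sqr.
set a := enorm u in pu *; set b := enorm v in pv *; set c := dotp u v.
have ab := mulr_gt0 pu pv.
move=> h; have : 0 <= 2 * (a * b) * (a * b - c) by nra.
by rewrite pmulr_rge0 ?subr_ge0// mulr_gt0.
Qed.

Lemma dotp_norm_le u v : `|dotp u v| <= enorm u * enorm v.
Proof.
rewrite ler_norml dotp_le andbT lerNl -dotpNl -(enormN u).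
exact: dotp_le.
Qed.

Lemma enormD u v : enorm (u + v) <= enorm u + enorm v.
Proof.
rewrite -(@ler_pXn2r _ 2)// ?nnegrE ?addr_ge0 ?enorm_ge0//.
rewrite enorm_sqr dotpDl !(dotpC _ (u + v)) !dotpDl -!enorm_sqr (dotpC v u).
by have := dotp_le u v; nra.
Qed.

Lemma enorm_coord u i : `|u 0 i| <= enorm u.
Proof.
rewrite -(@ler_pXn2r _ 2)// ?nnegrE ?enorm_ge0// enorm_sqr real_normK ?num_real//.
rewrite /dotp (bigD1 i)//= -expr2 lerDl sumr_ge0// => j _.
by rewrite -expr2 sqr_ge0.
Qed.

Lemma norm_le_enorm u : `|u| <= enorm u.
Proof.
rewrite [`|u|]mx_normrE; apply/bigmax_leP; split => [|[i j] _ /=].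
  exact: enorm_ge0.
by rewrite ord1 enorm_coord.
Qed.

Lemma coord_le_norm u i : `|u 0 i| <= `|u|.
Proof.
by rewrite [`|u|]mx_normrE; apply: (le_bigmax _ (fun p => `|u p.1 p.2|) (0, i)).
Qed.

Lemma enorm_le_norm u : enorm u <= n%:R * `|u|.
Proof.
rewrite -(@ler_pXn2r _ 2)// ?nnegrE ?enorm_ge0 ?mulr_ge0// enorm_sqr.
apply: (@le_trans _ _ (\sum_(i < n) `|u| ^+ 2)).
  apply: ler_sum => i _; rewrite -expr2 -(real_normK (num_real (u 0 i))).
  by rewrite ler_pXn2r ?nnegrE//; exact: coord_le_norm.
rewrite sumr_const card_ord -[leLHS]mulr_natl exprMn ler_wpM2r ?sqr_ge0//.
by rewrite -natrX ler_nat; case: (n) => // k; rewrite -mulnn leq_pmulr.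
Qed.

Lemma eucl_distxx x : eucl_dist x x = 0.
Proof. by rewrite /eucl_dist subrr enorm0. Qed.

Lemma eucl_distC x y : eucl_dist x y = eucl_dist y x.
Proof. exact: enormB. Qed.

Lemma eucl_dist_triangle x y z : eucl_dist x z <= eucl_dist x y + eucl_dist y z.
Proof. by rewrite /eucl_dist -{1}(subrK y x) -addrA enormD. Qed.

Lemma open_eucl_ball x r : open [set y | eucl_dist x y < r].
Proof.
rewrite openE => y /= yr; apply/nbhs_ballP.
exists ((r - eucl_dist x y) / n.+1%:R) => /=.
  by rewrite divr_gt0// subr_gt0.
move=> z; rewrite -ball_normE /= => yz.
apply: le_lt_trans (eucl_dist_triangle x y z) _.
rewrite -ltrBrDl; apply: le_lt_trans (enorm_le_norm _) _.
apply: (@le_lt_trans _ _ (n.+1%:R * `|y - z|)).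
  by rewrite ler_wpM2r// ler_nat.
by rewrite mulrC -ltr_pdivlMr.
Qed.

End EuclideanNorm.

(** * Finite approximation and Assouad exponents *)

Section Approximation.
Context {R : realType} {X Y : Type} (dX : X -> X -> R) (dY : Y -> Y -> R).
Hypothesis dXC : forall x y, dX x y = dX y x.
Hypothesis dX_triangle : forall x y z, dX x z <= dX x y + dX y z.

(** Finite pieces of A are reproduced in B, up to scaling and a small error. Only
    mutual distances matter, so that A and B may lie in different spaces. *)
Definition approximable (A : set X) (B : set Y) :=
  forall (k : nat) (p : 'I_k -> X) (e : R), (forall i, A (p i)) -> 0 < e ->
    exists (b : 'I_k -> Y) (l : R),
      [/\ 0 < l, forall i, B (b i) &
          forall i j, `|dY (b i) (b j) - l * dX (p i) (p j)| <= l * e].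

Definition separated (A : set X) (r : R) (k : nat) (p : 'I_k -> X) :=
  (forall i, A (p i)) /\ forall i j, i != j -> r < dX (p i) (p j).

(** A separated family of maximal size is a net. *)
Lemma maximal_separated (A : set X) (r : R) (M : nat) :
  (forall k p, @separated A r k p -> (k <= M)%N) ->
  exists k p, @separated A r k p /\
    forall y, A y -> exists i, dX (p i) y <= r.
Proof.
move=> bM.
pose P k := `[< exists p, @separated A r k p >].
have P0 : exists k, P k.
  by exists 0%N; apply/asboolP; exists (fun i : 'I_0 => False_rect X (notF (ltn_ord i))); split => -[].
have PM k : P k -> (k <= M)%N by move=> /asboolP[p /bM].
case: (ex_maxnP P0 PM) => k /asboolP[p [Ap sp]] kmax.
exists k, p; split => // y Ay; apply: contrapT => /forallNP far.
suff /kmax : P k.+1 by rewrite ltnn.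
apply/asboolP.
pose p' (i : 'I_k.+1) := if unlift ord_max i is Some j then p j else y.
exists p'; split => [i|i j]; rewrite /p'.
  by case: unliftP.
case: (unliftP ord_max i) => [i' ->|->]; case: (unliftP ord_max j) => [j' ->|->].
- by rewrite (inj_eq lift_inj); exact: sp.
- by move=> _; rewrite ltNge; apply/negP/far.
- by move=> _; rewrite dXC ltNge; apply/negP/far.
- by rewrite eqxx.
Qed.

(** An Assouad exponent bounds the sizes of separated families, and these are
    finite configurations, which an approximable set shares with its model. *)
Lemma assouad_exponent_approximable (A : set X) (B : set Y) (a : R) :
  0 <= a -> approximable A B -> assouad_exponent dY B a ->
  assouad_exponent dX A a.
Proof.
move=> a0 AB [C C0 BC].
exists (C * 8 `^ a); first by rewrite mulr_gt0// powR_gt0.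
move=> x r rho Ax r0 rrho.
have rho0 : 0 < rho by exact: lt_trans rrho.
pose Ax_rho := A `&` closed_ball_of dX x rho.
have bound k p : @separated Ax_rho (r / 2) k p ->
    k%:R < C * 8 `^ a * (rho / r) `^ a.
  move=> [Ap sp].
  pose p' (i : 'I_k.+1) := if unlift ord_max i is Some j then p j else x.
  have p'l j : p' (lift ord_max j) = p j by rewrite /p' liftK.
  have p'm : p' ord_max = x by rewrite /p' unlift_none.
  have Ap' i : A (p' i).
    by rewrite /p'; case: unliftP => // j _; case: (Ap j).
  have [|b [l [l0 Bb bl]]] := AB _ p' (r / 16) Ap'; first by rewrite divr_gt0.
  have [||k' [U [k'C Ud BU]]] := BC (b ord_max) (l * (r / 4)) (l * (2 * rho)) (Bb _).
  - by rewrite mulr_gt0// divr_gt0.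
  - by rewrite ltr_pM2l//; lra.
  have -> : C * 8 `^ a * (rho / r) `^ a =
            C * ((l * (2 * rho)) / (l * (r / 4))) `^ a.
    rewrite -mulrA -powRM ?divr_ge0 ?ltW//; congr (_ * _ `^ _).
    by field; rewrite !gt_eqF.
  apply: le_lt_trans k'C; rewrite ler_nat.
  have /choice[f fU] : forall i : 'I_k, exists j : 'I_k', U j (b (lift ord_max i)).
    move=> i; have [|j _ ?] := BU (b (lift ord_max i)); last by exists j.
    split; first exact: Bb.
    have := bl ord_max (lift ord_max i); rewrite p'm p'l /closed_ball_of /=.
    have [_ xp] := Ap i; rewrite /closed_ball_of/= in xp.
    rewrite ler_distl => /andP[_ h]; apply: le_trans h _.
    by rewrite -mulrDr ler_pM2l//; lra.
  have fI : injective f.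
    move=> i j fij; apply/eqP/negPn/negP => ij.
    have := bl (lift ord_max i) (lift ord_max j); rewrite !p'l.
    have d1 : dY (b (lift ord_max i)) (b (lift ord_max j)) <= l * (r / 4).
      rewrite -lee_fin; apply: le_trans (Ud (f i)); apply: diameter_ge => //.
      by rewrite fij.
    rewrite ler_distl => /andP[h _].
    have := le_trans h d1; rewrite -mulrBr ler_pM2l//.
    by have := sp _ _ ij; lra.
  by have := leq_card f fI; rewrite !card_ord.
have [|k [p [sp cov]]] := @maximal_separated Ax_rho (r / 2)
    (Num.bound (C * 8 `^ a * (rho / r) `^ a)).
  move=> k p /bound kC; rewrite -(ler_nat R); apply/ltW/(lt_trans kC).
  by apply: archi_boundP; rewrite !mulr_ge0 ?powR_ge0 ?ltW.
exists k, (fun i => [set y | dX (p i) y <= r / 2]); split => //.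
- exact: bound sp.
- move=> i; apply: diameter_le; first exact: ltW.
  move=> y z /= py pz; apply: le_trans (dX_triangle _ (p i) _) _.
  by rewrite dXC; lra.
- by move=> y /cov[i ?]; exists i.
Qed.

End Approximation.

Section ExponentCriterion.
Context {R : realType} {n : nat}.
Implicit Types (F A : set 'rV[R]_n) (z : 'rV[R]_n) (s : seq ('rV[R]_n * R)).

Definition balls s (y : 'rV[R]_n) : bool :=
  has (fun c => eucl_dist c.1 y <= c.2) s.

(** The covers of balls by smaller balls of comparable radii are iterated until
    the radii fall below the required scale; the sum of the t-th powers of the
    radii does not increase on the way, which bounds the number of balls. *)
Lemma assouad_exponent_of_balls F (h t : R) : 0 < h <= 1 -> 0 <= t ->
  (forall z rho, 0 < rho -> exists s,
     [/\ forall c, c \in s -> h * rho <= c.2 <= rho / 2,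
         forall y, F y -> eucl_dist z y <= rho -> balls s y &
         \sum_(c <- s) c.2 `^ t <= rho `^ t]) ->
  assouad_exponent eucl_dist F t.
Proof.
move=> /andP[h0 h1] t0 H.
have main r : 0 < r -> forall m z rho, 0 < rho -> rho <= r * 2 ^+ m ->
    exists l : seq 'rV[R]_n,
      (size l)%:R <= Num.max 1 ((rho / (h * r)) `^ t) /\
      forall y, F y -> eucl_dist z y <= rho ->
        has (fun c => eucl_dist c y <= r) l.
  move=> r0; elim => [|m IH] z rho rho0 rhom.
    exists [:: z]; split; first by rewrite le_max lexx.
    by move=> y _ zy /=; rewrite orbF (le_trans zy)// (le_trans rhom)// mulr1.
  have [rr|rr] := leP rho r.
    exists [:: z]; split; first by rewrite le_max lexx.
    by move=> y _ zy /=; rewrite orbF (le_trans zy).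
  have [s [sb cov sums]] := H z rho rho0.
  have hr0 : 0 < h * r by rewrite mulr_gt0.
  suff [l [lS lcov]] : exists l : seq 'rV[R]_n,
      (size l)%:R <= \sum_(c <- s) (c.2 / (h * r)) `^ t /\
      forall y, F y -> balls s y -> has (fun c => eucl_dist c y <= r) l.
    exists l; split => [|y Fy /(cov y Fy)]; last exact: lcov.
    rewrite le_max; apply/orP; right; apply: (le_trans lS).
    have ir0 : 0 <= (h * r)^-1 by rewrite invr_ge0 ltW.
    rewrite powRM ?(ltW rho0)//.
    apply: le_trans (ler_wpM2r (powR_ge0 _ _) sums).
    rewrite mulr_suml big_seq [leRHS]big_seq; apply: ler_sum => c /sb /andP[c1 c2].
    rewrite powRM//; apply: le_trans c1.
    by rewrite mulr_ge0 ?ltW.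
  elim: s sb {cov sums} => [|c s IHs] sb.
    by exists [::]; rewrite big_nil; split.
  have [|l [lS lcov]] := IHs; first by move=> c' cs; apply: sb; rewrite inE cs orbT.
  have /andP[c1 c2] := sb c (mem_head _ _).
  have c0 : 0 < c.2 by apply: lt_le_trans c1; rewrite mulr_gt0.
  have [|l' [l'S l'cov]] := IH c.1 c.2 c0.
    by apply: (le_trans c2); move: rhom; rewrite exprS; lra.
  exists (l' ++ l); rewrite big_cons size_cat natrD; split.
    apply: lerD => //; apply: le_trans l'S _.
    rewrite ge_max lexx andbT.
    have : 1 <= c.2 / (h * r).
      rewrite ler_pdivlMr// mul1r; apply: le_trans c1.
      by rewrite ler_pM2l// ltW.
    by move=> ge1; rewrite -{1}(powRr0 (c.2 / (h * r))) ler_powR.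
  move=> y Fy /= /orP[cy|sy]; rewrite has_cat.
    by rewrite l'cov.
  by rewrite lcov ?orbT.
exists ((2 / h) `^ t + 1); first by rewrite ltr_wpDl// powR_ge0.
move=> x r rho Fx r0 rrho.
have rho0 : 0 < rho by exact: lt_trans rrho.
have r20 : 0 < r / 2 by rewrite divr_gt0.
have [m rm] : exists m, rho <= r / 2 * 2 ^+ m.
  exists (Num.bound (rho / (r / 2))); rewrite mulrC -ler_pdivrMr//.
  have q0 : 0 <= rho / (r / 2) by rewrite divr_ge0 ?ltW.
  apply: (@le_trans _ _ (Num.bound (rho / (r / 2)))%:R).
    exact/ltW/archi_boundP.
  by rewrite -natrX ler_nat ltnW// ltn_expl.
have [l [lS lcov]] := main _ r20 m x rho rho0 rm.
exists (size l), (fun i => [set y | eucl_dist (nth 0 l i) y <= r / 2]); split.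
- apply: (le_lt_trans lS).
  have -> : rho / (h * (r / 2)) = (2 / h) * (rho / r).
    by field; rewrite !gt_eqF.
  have ge1 : 1 <= (rho / r) `^ t.
    rewrite -(powRr0 (rho / r)) ler_powR// ler_pdivlMr// mul1r ltW//.
  have [u0 v0] : 0 <= 2 / h /\ 0 <= rho / r by rewrite !divr_ge0 ?ltW.
  rewrite (powRM _ u0 v0) [ltRHS]mulrDl mul1r.
  have p1 : 0 < (2 / h) `^ t * (rho / r) `^ t.
    by rewrite mulr_gt0// powR_gt0 ?divr_gt0.
  rewrite gt_max; apply/andP; split; first exact: ltr_pwDl.
  by rewrite ltrDl (lt_le_trans ltr01).
- move=> i; apply: diameter_le; first exact: ltW.
  move=> y z /= py pz; apply: le_trans (eucl_dist_triangle _ (nth 0 l i) _) _.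
  by rewrite eucl_distC; lra.
- move=> y [Fy xy].
  have /(has_nthP 0)[i il yi] := lcov y Fy xy.
  by exists (Ordinal il).
Qed.

End ExponentCriterion.

(** * Limits of sets *)

Lemma bool_branch (P : seq bool -> Prop) : P [::] ->
  (forall u, P u -> exists b, P (rcons u b)) ->
  exists h : nat -> bool, forall i, P (mkseq h i).
Proof.
move=> P0 Pstep.
pose next u := `[< P (rcons u true) >].
pose fix U i := if i is j.+1 then rcons (U j) (next (U j)) else [::].
pose h i := next (U i).
have UE i : mkseq h i = U i.
  by elim: i => [|i IH]; [|rewrite mkseqS IH].
exists h => i; rewrite UE; elim: i => //= i /Pstep[b Pb].
rewrite /next; case: asboolP => // nP.
by case: b Pb.
Qed.

Section SetLimits.
Context {R : realType} {n : nat}.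
Implicit Types (A F K : set 'rV[R]_n) (p x y z : 'rV[R]_n) (u : seq bool).

(** A countable basis of the topology: balls with rational centres and radii
    1/(k+1). *)
Definition basic_ball (l : nat) : set 'rV[R]_n :=
  if (unpickle l : option ('rV[rat]_n * nat)%type) is Some c
  then [set y | eucl_dist (map_mx ratr c.1) y < c.2.+1%:R^-1] else set0.

Lemma open_basic_ball l : open (basic_ball l).
Proof.
rewrite /basic_ball; case: unpickle => [c|]; last exact: open0.
exact: open_eucl_ball.
Qed.

Lemma basic_ball_small p (e : R) : 0 < e ->
  exists2 l, basic_ball l p & forall y, basic_ball l y -> eucl_dist p y < e.
Proof.
move=> e0; pose k := Num.bound (2 / e).
have k0 : 0 < k.+1%:R^-1 :> R by rewrite invr_gt0.
have ke : k.+1%:R^-1 + k.+1%:R^-1 < e :> R.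
  have : 2 / e < k.+1%:R.
    apply: (@lt_le_trans _ _ k%:R); last by rewrite ler_nat.
    by apply: archi_boundP; rewrite divr_ge0// ltW.
  rewrite ltr_pdivrMr// -ltr_pdivrMl// => h.
  by move: h; rewrite mulr_natr mulr2n.
have d0 : 0 < k.+1%:R^-1 / n.+1%:R :> R by rewrite divr_gt0.
have /choice[q qP] : forall i : 'I_n, exists q : rat,
    `|ratr q - p 0 i| < k.+1%:R^-1 / n.+1%:R.
  move=> i; have [|q] := @rat_in_itvoo R (p 0 i - k.+1%:R^-1 / n.+1%:R)
    (p 0 i + k.+1%:R^-1 / n.+1%:R).
    by rewrite ltrBlDr -addrA ltrDl addr_gt0.
  by rewrite in_itv /= => qi; exists q; rewrite ltr_distl.
pose c : 'rV[rat]_n := \row_i q i.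
have pc : eucl_dist (map_mx ratr c) p < k.+1%:R^-1.
  apply: (le_lt_trans (enorm_le_norm _)).
  apply: (@le_lt_trans _ _ (n%:R * (k.+1%:R^-1 / n.+1%:R))).
    apply: ler_wpM2l => //.
    rewrite [`|_|]mx_normrE; apply/bigmax_leP; split => [|[i j] _ /=].
      exact: ltW.
    by rewrite ord1 !mxE ltW.
  by rewrite mulrA ltr_pdivrMr// mulrC ltr_pM2l// ltr_nat.
exists (pickle (c, k)); first by rewrite /basic_ball pickleK.
move=> y; rewrite /basic_ball pickleK /= => cy.
apply: le_lt_trans (eucl_dist_triangle _ (map_mx ratr c) _) _.
by rewrite eucl_distC; apply: lt_trans ke; rewrite ltrD.
Qed.

Definition hits K (l : nat) : bool := `[< exists y, K y /\ basic_ball l y >].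

(** The word u tells which of the first basic balls meet K. *)
Definition matches u K : Prop := mkseq (hits K) (size u) = u.

Lemma matches_rcons u b K :
  matches u K -> hits K (size u) = b -> matches (rcons u b) K.
Proof. by rewrite /matches size_rcons mkseqS => -> ->. Qed.

Lemma matches_lt (h : nat -> bool) i l K :
  matches (mkseq h i) K -> (l < i)%N -> hits K l = h l.
Proof.
rewrite /matches size_mkseq => KE li.
by rewrite -(nth_mkseq false (hits K) li) KE nth_mkseq.
Qed.

Lemma matches_le (h : nat -> bool) i j K : (i <= j)%N ->
  matches (mkseq h j) K -> matches (mkseq h i) K.
Proof.
move=> ij KE; rewrite /matches size_mkseq; apply: (@eq_from_nth _ false).
  by rewrite !size_mkseq.
move=> l; rewrite size_mkseq => li; rewrite !nth_mkseq//.
by apply: matches_lt KE _; exact: leq_trans ij.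
Qed.

(** Compactness of the space of infinite words: some word has all its prefixes
    matched arbitrarily far along the decreasing families S. *)
Lemma matches_cluster (S : nat -> set (set 'rV[R]_n)) :
  (forall j, S j !=set0) -> (forall i j, (i <= j)%N -> S j `<=` S i) ->
  exists h : nat -> bool, forall i j, exists2 K, S j K & matches (mkseq h i) K.
Proof.
move=> S0 Sdec.
pose P u := forall j, exists2 K, S j K & matches u K.
apply: (@bool_branch P) => [j|u Pu].
  by have [K SK] := S0 j; exists K.
apply: contrapT => /forallNP nP.
have /existsNP[j1 n1] := nP true; have /existsNP[j2 n2] := nP false.
have [K SK uK] := Pu (maxn j1 j2).
case m : (hits K (size u)).
- apply: n1; exists K; last exact: matches_rcons.
  by apply: Sdec SK; exact: leq_maxl.
- apply: n2; exists K; last exact: matches_rcons.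
  by apply: Sdec SK; exact: leq_maxr.
Qed.

Definition cube : set 'rV[R]_n := [set p | forall i, `|p 0 i| <= 1].

Lemma compact_cube : compact cube.
Proof.
have := @rV_compact _ n (fun _ => `[-1, 1]%classic : set R).
move=> /(_ (fun=> @segment_compact _ _ _)); congr compact.
by apply/seteqP; split => p /= pP i; have := pP i; rewrite /= in_itv/= ler_norml.
Qed.

(** The largest closed set in the cube that avoids the balls to which h answers
    no. When sets in the cube match longer and longer prefixes of h, it is their
    limit for the Hausdorff distance. *)
Definition set_limit (h : nat -> bool) : set 'rV[R]_n :=
  [set p | cube p /\ forall l, basic_ball l p -> h l].

Lemma set_limit_near (h : nat -> bool) k (p : 'I_k -> 'rV[R]_n) (e : R) :
  0 < e -> (forall j, set_limit h (p j)) ->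
  exists i, forall K, matches (mkseq h i) K ->
    forall j, exists2 q, K q & eucl_dist (p j) q < e.
Proof.
move=> e0 hp.
have /choice[l lP] : forall j, exists l, basic_ball l (p j) /\
    forall y, basic_ball l y -> eucl_dist (p j) y < e.
  by move=> j; have [l ? ?] := basic_ball_small (p j) e0; exists l.
exists (\max_j l j).+1 => K KE j.
have : hits K (l j).
  rewrite (matches_lt KE); last by rewrite ltnS leq_bigmax.
  by apply: (hp j).2; case: (lP j).
by move=> /asboolP[y [Ky /(lP j).2]]; exists y.
Qed.

Lemma cube_finite_cover (W : nat -> set 'rV[R]_n) :
  (forall k, open (W k)) -> cube `<=` \bigcup_k W k ->
  exists m, forall y, cube y -> exists2 k, (k < m)%N & W k y.
Proof.
move=> oW cW.
pose P m y := exists2 k, (k < m)%N & W k y.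
have : \forall m \near \oo, cube `<=` P m.
  apply: (compact_near_coveringP cube).1 => //; first exact: compact_cube.
  move=> y /cW[k _ ky]; exists (W k, [set m | (k < m)%N]).
    by split; [exact: open_nbhs_nbhs (conj (oW k) ky)|exists k.+1].
  by move=> [x m] /= [Wx km]; exists k.
by case=> m _ /(_ m (leqnn m)) mP; exists m.
Qed.

(** The balls to which h answers no, together with an open cover of the limit,
    cover the cube, so finitely many of them do; the sets that match a long
    enough prefix avoid the former balls and lie in the latter. *)
Lemma set_limit_cover (h : nat -> bool) (c : nat -> 'rV[R]_n) (r : nat -> R) :
  (forall p, set_limit h p -> exists k, eucl_dist (c k) p < r k) ->
  exists m, forall K, K `<=` cube -> matches (mkseq h m) K ->
    forall y, K y -> exists2 k, (k < m)%N & eucl_dist (c k) y < r k.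
Proof.
move=> cov.
pose W k := [set y | eucl_dist (c k) y < r k] `|`
            (if h k then set0 else basic_ball k).
have [||m mP] := @cube_finite_cover W.
- move=> k; apply: openU; first exact: open_eucl_ball.
  by case: ifP => _; [exact: open0|exact: open_basic_ball].
- move=> y cy; have [hy|] := pselect (set_limit h y).
    by have [k ky] := cov y hy; exists k => //; left.
  move=> /not_andP[/(_ cy)//|/existsNP[l /not_implyP[ly /negP/negbTE hl]]].
  by exists l => //; right; rewrite hl.
exists m => K Kc KE y Ky.
have [k km [|hky]] := mP y (Kc y Ky); first by exists k.
have : hits K k.
  by apply/asboolP; exists y; split => //; case: ifP hky.
by rewrite (matches_lt KE km) => hk; move: hky; rewrite hk.
Qed.

Definition zoom A z (l : R) : set 'rV[R]_n :=
  [set p | enorm p <= 1 /\ A (z + l *: p)].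

Lemma zoom_cube A z l : zoom A z l `<=` cube.
Proof. by move=> p [p1 _] i; exact: le_trans (enorm_coord _ _) p1. Qed.

Lemma eucl_dist_affine z (l : R) x y : 0 < l ->
  eucl_dist (z + l *: x) (z + l *: y) = l * eucl_dist x y.
Proof.
move=> l0; rewrite /eucl_dist -[l in RHS]gtr0_norm// -enormZ; congr enorm.
by rewrite opprD addrACA subrr add0r scalerBr.
Qed.

(** A weak tangent without compactness requirements: finite pieces of A are
    limits of enlarged finite pieces of F. *)
Definition affinely_tangent A F := forall k (p : 'I_k -> 'rV[R]_n) (e : R),
  0 < e -> (forall i, A (p i)) ->
  exists (z : 'rV[R]_n) (l : R) (b : 'I_k -> 'rV[R]_n),
    0 < l /\ forall i, F (b i) /\ eucl_dist (z + l *: p i) (b i) <= l * e.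

Lemma affinely_tangent_trans A F G :
  affinely_tangent A F -> affinely_tangent F G -> affinely_tangent A G.
Proof.
move=> AF FG k p e e0 Ap.
have e20 : 0 < e / 2 by rewrite divr_gt0.
have [z [l [b [l0 bP]]]] := AF k p _ e20 Ap.
have le0 : 0 < l * (e / 2) by rewrite mulr_gt0.
have [z' [l' [b' [l'0 b'P]]]] := FG k b _ le0 (fun i => (bP i).1).
exists (z' + l' *: z), (l' * l), b'; split; first exact: mulr_gt0.
move=> i; split; first exact: (b'P i).1.
apply: le_trans (eucl_dist_triangle _ (z' + l' *: b i) _) _.
have -> : z' + l' *: z + (l' * l) *: p i = z' + l' *: (z + l *: p i).
  by rewrite scalerDr addrA scalerA.
rewrite eucl_dist_affine//; have := (b'P i).2; have := (bP i).2.
rewrite -(ler_pM2l l'0); lra.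
Qed.

Lemma affinely_tangent_approximable A F :
  affinely_tangent A F -> approximable eucl_dist eucl_dist A F.
Proof.
move=> AF k p e Ap e0; have e20 : 0 < e / 2 by rewrite divr_gt0.
have [z [l [b [l0 bP]]]] := AF k p _ e20 Ap.
exists b, l; split => // [i|i j]; first exact: (bP i).1.
rewrite -(eucl_dist_affine z _ _ l0).
have := (bP i).2; have := (bP j).2.
set x := z + l *: p i; set y := z + l *: p j => yj xi.
have := eucl_dist_triangle (b i) x (b j); have := eucl_dist_triangle x y (b j).
have := eucl_dist_triangle x (b i) y; have := eucl_dist_triangle (b i) (b j) y.
rewrite (eucl_distC (b i) x) (eucl_distC (b j) y) ler_distl => *.
apply/andP; split; lra.
Qed.

(** Subsets of the enlargements suffice, as the points that approximate the limit
    belong to them. *)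
Lemma set_limit_tangent (h : nat -> bool) A :
  (forall i, exists z (l : R) K,
     [/\ 0 < l, K `<=` zoom A z l & matches (mkseq h i) K]) ->
  affinely_tangent (set_limit h) A.
Proof.
move=> hA k p e e0 hp.
have [i iP] := set_limit_near e0 hp.
have [z [l [K [l0 KA /iP near]]]] := hA i.
have /choice[q qP] : forall j, exists q, zoom A z l q /\ eucl_dist (p j) q < e.
  by move=> j; have [q /KA ? ?] := near j; exists q.
exists z, l, (fun j => z + l *: q j); split => // j; split.
  exact: (qP j).1.2.
by rewrite eucl_dist_affine// ler_pM2l// ltW// (qP j).2.
Qed.

End SetLimits.

(** * Balls carrying much content *)

Section ContentEuclidean.
Context {R : realType} {n : nat} (s : R).
Hypothesis s0 : 0 < s.
Implicit Types (A K : set 'rV[R]_n) (z : 'rV[R]_n).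
Local Notation hcontent := (hcontent (@eucl_dist R n) s).

Definition eball z (l : R) : set 'rV[R]_n := [set y | eucl_dist z y <= l].

Lemma hcontent_cover_le A (U : nat -> set 'rV[R]_n) (r : nat -> R) :
  (forall i, 0 < r i) -> (forall i, diam_le eucl_dist (r i) (U i)) ->
  A `<=` \bigcup_i U i -> (hcontent A <= \sum_(0 <= i <oo) (r i `^ s)%:E)%E.
Proof.
move=> r0 Ur AU; apply: le_trans (le_hcontent AU) _.
apply: le_trans (hcontent_bigcup U) _.
apply: lee_nneseries => [i _ _|i _]; first exact: hcontent_ge0.
exact: hcontent_le.
Qed.

(** A cover of the enlargement can be shrunk back. *)
Lemma hcontent_zoom A z (c l : R) : 0 < l ->
  ((c * l `^ s)%:E <= hcontent (A `&` eball z l))%E ->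
  (c%:E <= hcontent (zoom A z l))%E.
Proof.
move=> l0 cA; rewrite leNgt; apply/negP.
move=> /hcontent_cover[U [r [r0 Ur AU]]]; apply/negP; rewrite -leNgt.
have ls0 : 0 < l `^ s by exact: powR_gt0.
suff : ((l `^ s)%:E * c%:E <=
        (l `^ s)%:E * \sum_(0 <= i <oo) (r i `^ s)%:E)%E.
  by rewrite lee_pmul2l.
rewrite -nneseriesZl; last by move=> i _; rewrite lee_fin powR_ge0.
rewrite -EFinM mulrC; apply: le_trans cA _.
apply: le_trans (@hcontent_cover_le _ (fun i => [set y | U i (l^-1 *: (y - z))])
  (fun i => l * r i) _ _ _) _.
- by move=> i; exact: mulr_gt0.
- move=> i x y /= /(Ur i) h /h {h}.
  rewrite /eucl_dist -scalerBr opprB addrA subrK enormZ.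
  by rewrite gtr0_norm ?invr_gt0// ler_pdivrMl.
- move=> y [Ay zy]; have /AU[i _ Ui] : zoom A z l (l^-1 *: (y - z)).
    split; last by rewrite scalerA divff ?gt_eqF// scale1r addrC subrK.
    rewrite enormZ gtr0_norm ?invr_gt0// ler_pdivrMl// mulr1.
    by move: zy; rewrite /eball /= eucl_distC.
  by exists i.
- apply: lee_nneseries => [i _ _|i _]; first by rewrite lee_fin powR_ge0.
  by rewrite (powRM _ (ltW l0) (ltW (r0 i))) EFinM.
Qed.

(** If the content of A in each ball of radius at most rho0 were less than half of
    the s-th power of the radius, then any economical cover of the part of A in
    such a ball could be replaced by one of half the cost, so that this part
    would be null. *)
Lemma thick_ball A (rho0 : R) : hcontent A != 0%E -> 0 < rho0 ->
  exists z l, [/\ 0 < l, l <= rho0 &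
    ((2^-1 * l `^ s)%:E <= hcontent (A `&` eball z l))%E].
Proof.
move=> An0 rho00; apply: contrapT => nthick; move/negP: An0; apply; apply/eqP.
have thin z l : 0 < l -> l <= rho0 ->
    (hcontent (A `&` eball z l) < (2^-1 * l `^ s)%:E)%E.
  by move=> *; rewrite ltNge; apply/negP => ?; apply: nthick; exists z, l.
have local_null z : hcontent (A `&` eball z rho0) = 0%E.
  set A' := A `&` _.
  have A'lt := thin z rho0 rho00 (lexx _); rewrite -/A' in A'lt.
  have A'fin : hcontent A' \is a fin_num.
    by rewrite ge0_fin_numE ?hcontent_ge0// (lt_trans A'lt)// ltry.
  apply/eqP/negPn/negP => A'0.
  have c0 : 0 < fine (hcontent A').
    by rewrite fine_gt0// -ge0_fin_numE ?hcontent_ge0// A'fin andbT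
      lt_neqAle eq_sym A'0 hcontent_ge0.
  set c := fine _ in c0.
  have cE : hcontent A' = c%:E by rewrite fineK.
  have crho : c < 2^-1 * rho0 `^ s by rewrite -lte_fin -cE.
  have := @hcontent_cover _ _ (@eucl_dist R n) s A'
    (Num.min (2 * c) (rho0 `^ s))%:E.
  rewrite cE lte_fin lt_min => -[|U [r [r0 Ur AU]]].
    by have ? := powR_gt0 s rho00; apply/andP; split; lra.
  set S := (\sum_(0 <= i <oo) _)%E => Slt.
  have rrho i : r i <= rho0.
    have := nneseries_term i (fun k => powR_ge0 (r k) s) (ltW Slt).
    rewrite le_min => /andP[_ rs]; rewrite leNgt; apply/negP.
    move=> /(gt0_ltr_powR s0); rewrite !nnegrE => /(_ (ltW rho00) (ltW (r0 i))).
    by rewrite ltNge rs.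
  have : (hcontent A' <= 2^-1%:E * S)%E.
    rewrite /S -nneseriesZl; last by move=> i _; rewrite lee_fin powR_ge0.
    apply: (@le_trans _ _ (hcontent (\bigcup_i (A' `&` U i)))).
      by apply: le_hcontent => y A'y; have [i _ ?] := AU y A'y; exists i.
    apply: le_trans (hcontent_bigcup _) _.
    apply: lee_nneseries => [i _ _|i _]; first exact: hcontent_ge0.
    have [[u [A'u Uu]]|/set0P/negP/negPn/eqP->] :=
        pselect (A' `&` U i !=set0); last first.
      by rewrite hcontent0// mule_ge0// lee_fin powR_ge0.
    rewrite -EFinM; apply: le_trans (ltW (thin u (r i) (r0 i) (rrho i))).
    by apply: le_hcontent => y [[Ay _] Uy]; split => //; exact: Ur.
  rewrite cE leNgt => /negP; apply.
  have Sfin : S \is a fin_num.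
    rewrite ge0_fin_numE ?(lt_trans Slt) ?ltry//.
    by apply: nneseries_ge0 => *; rewrite lee_fin powR_ge0.
  move: Slt; rewrite -(fineK Sfin) -EFinM !lte_fin lt_min => /andP[? _].
  lra.
pose W l : set 'rV[R]_n :=
  if `[< exists z, basic_ball l `<=` eball z rho0 >] then basic_ball l else set0.
have -> : A = \bigcup_l (A `&` W l).
  apply/seteqP; split => [y Ay|y [l _ [Ay _]]//].
  have [l ly lb] := basic_ball_small y rho00.
  exists l => //; split => //; rewrite /W; case: asboolP => // -[].
  by exists y => x /lb/ltW.
apply: hcontent_null_bigcup => // l; rewrite /W; case: asboolP => [[z lz]|_].
  apply/eqP; rewrite eq_le hcontent_ge0 andbT -(local_null z).
  by apply: le_hcontent; apply: setIS.
by rewrite setI0 (hcontent0 s0).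
Qed.

(** A cheap cover of a null limit by open balls can be taken finite, and then it
    covers all sets that are close enough to the limit. *)
Lemma null_set_limit (h : nat -> bool) (e : R) :
  hcontent (set_limit h) = 0%E -> 0 < e ->
  exists (c : nat -> 'rV[R]_n) (r : nat -> R) (m : nat),
    [/\ forall k, 0 < r k, forall k, r k `^ s <= e,
        \sum_(0 <= k < m) r k `^ s <= e &
        forall K, K `<=` @cube R n -> matches (mkseq h m) K ->
          forall y, K y -> exists2 k, (k < m)%N & eucl_dist (c k) y < r k].
Proof.
move=> h0 e0.
have p2 : 0 < 2 `^ s :> R by exact: powR_gt0.
have := @hcontent_cover _ _ (@eucl_dist R n) s (set_limit h) (e / 2 `^ s)%:E.
rewrite h0 lte_fin divr_gt0// => -[//|U [r [r0 Ur hU Sr]]].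
pose c k := xget 0 (U k).
have cov p : set_limit h p -> exists k, eucl_dist (c k) p < 2 * r k.
  move=> /hU[k _ Up]; exists k.
  have Uc : U k (c k) by exact: (@xgetPex _ _ (U k)) (ex_intro _ p Up).
  apply: le_lt_trans (Ur k _ _ Uc Up) _.
  by have := r0 k; lra.
have [m mP] := set_limit_cover cov.
have S2 : (\sum_(0 <= k <oo) ((2 * r k) `^ s)%:E <= e%:E)%E.
  have -> : (\sum_(0 <= k <oo) ((2 * r k) `^ s)%:E =
             (2 `^ s)%:E * \sum_(0 <= k <oo) (r k `^ s)%:E)%E.
    rewrite -nneseriesZl; last by move=> i _; rewrite lee_fin powR_ge0.
    by apply: eq_eseriesr => i _; rewrite powRM ?ltW// EFinM.
  by rewrite muleC -lee_pdivlMr// -EFinM ltW.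
exists c, (fun k => 2 * r k), m; split => //.
- by move=> k; rewrite mulr_gt0.
- by move=> k; apply: (nneseries_term k _ S2) => i; exact: powR_ge0.
- rewrite -lee_fin; apply: le_trans S2; rewrite -sumEFin.
  by apply: nneseries_lim_ge => *; rewrite lee_fin powR_ge0.
Qed.

(** Hausdorff content is upper semicontinuous on compact sets. *)
Lemma hcontent_set_limit (h : nat -> bool) (c : R) : 0 < c ->
  (forall i, exists K, [/\ K `<=` @cube R n, matches (mkseq h i) K &
                           (c%:E <= hcontent K)%E]) ->
  hcontent (set_limit h) != 0%E.
Proof.
move=> c0 hK; apply/negP => /eqP h0.
have p2 : 0 < 2 `^ s :> R by exact: powR_gt0.
have [|z [r [m [r0 _ Sr cov]]]] := null_set_limit h0 (_ : 0 < c / 2 / 2 `^ s).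
  by rewrite !divr_gt0.
have [K [Kc Km cK]] := hK m.
have : (hcontent K <= \sum_(k <- iota 0 m) ((2 * r k) `^ s)%:E)%E.
  apply: (hcontent_seq s0 _ _ (fun k => [set y | eucl_dist (z k) y < r k])) => //.
    move=> k; apply: hcontent_le => //; first by rewrite mulr_gt0.
    move=> x y /= zx zy; apply: le_trans (eucl_dist_triangle _ (z k) _) _.
    by rewrite eucl_distC; lra.
  move=> y /(cov K Kc Km)[k km ky]; apply/hasP; exists k.
    by rewrite mem_iota.
  exact/asboolP.
move=> /(le_trans cK); rewrite sumEFin lee_fin leNgt => /negP; apply.
apply: (@le_lt_trans _ _ (2 `^ s * \sum_(0 <= k < m) r k `^ s)).
  rewrite mulr_sumr /index_iota subn0; apply: ler_sum => k _.
  by rewrite powRM// ltW.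
rewrite mulrC -ltr_pdivlMr//; apply: le_lt_trans Sr _.
rewrite ltr_pM2r ?invr_gt0//; lra.
Qed.

End ContentEuclidean.

(** * Weak tangents of full dimension *)

Section ScaleInvariance.
Context {R : realType} {n : nat}.
Implicit Types (F A K W : set 'rV[R]_n) (x y z p : 'rV[R]_n) (u : seq bool).

(** The unit ball is covered by some number m of balls of radius one half, and
    m is at most 2 to the power m; hence m is an exponent. *)
Lemma assouad_exponent_exists F :
  exists2 t : R, 0 <= t & assouad_exponent eucl_dist F t.
Proof.
pose c k : 'rV[R]_n := xget 0 (basic_ball k).
pose B k := [set y : 'rV[R]_n | eucl_dist (c k) y < 2^-1].
have [||m mP] := @cube_finite_cover R n B.
- by move=> k; exact: open_eucl_ball.
- move=> y _; have h0 : 0 < 4^-1 :> R by rewrite invr_gt0.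
  have [l ly lP] := basic_ball_small y h0; exists l => //.
  have cl : basic_ball l (c l) := xgetPex 0 (ex_intro _ y ly).
  by rewrite /B /= eucl_distC; apply: lt_le_trans (lP _ cl) _; lra.
exists m%:R => //.
apply: (@assouad_exponent_of_balls _ _ _ 2^-1) => //; first by lra.
move=> z rho rho0.
exists [seq (z + rho *: c k, rho / 2) | k <- iota 0 m]; split.
- by move=> _ /mapP[k _ ->] /=; rewrite mulrC lexx.
- move=> y _ zy; pose y' := rho^-1 *: (y - z).
  have yE : y = z + rho *: y' by rewrite scalerA divff ?gt_eqF// scale1r addrC subrK.
  have [|k km ky'] := mP y'.
    move=> i; apply: le_trans (enorm_coord _ _) _.
    rewrite enormZ gtr0_norm ?invr_gt0// ler_pdivrMl// mulr1.
    by move: zy; rewrite eucl_distC.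
  apply/hasP; exists (z + rho *: c k, rho / 2).
    by apply: map_f; rewrite mem_iota.
  by rewrite /= yE eucl_dist_affine// ler_pM2l// ltW.
- rewrite big_map /= big_const_seq count_predT size_iota iter_addr addr0.
  rewrite -[leLHS]mulr_natr powRM ?invr_ge0 ?(ltW rho0)// -mulrA.
  rewrite -[leRHS]mulr1 ler_pM2l ?powR_gt0//.
  rewrite -powR_inv1// -powRrM mulN1r powRN powR_mulrn//.
  rewrite mulrC ler_pdivrMr ?exprn_gt0// mul1r -natrX ler_nat.
  exact/ltnW/ltn_expl.
Qed.

(** The finitary form of content one half, which only involves covers by balls
    whose radii are bounded below, so that it can be tested on approximations. *)
Definition thick_at_scale (s h : R) K := forall l : seq ('rV[R]_n * R),
  (forall c, c \in l -> h <= c.2 <= 2^-1) -> (forall y, K y -> balls l y) ->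
  2^-1 <= \sum_(c <- l) c.2 `^ s.

(** Otherwise every ball has a cover by balls of comparable radii whose cost in
    dimension s is less than half of the s-th power of its radius. As the radii
    are bounded below, the same covers are cheap in a slightly smaller dimension,
    which would then be an exponent of F. *)
Lemma thick_zoom (s h : R) F : 0 < s -> 0 < h <= 2^-1 ->
  (forall t : R, 0 <= t -> t < s -> ~ assouad_exponent eucl_dist F t) ->
  exists z (l : R), 0 < l /\ thick_at_scale s h (zoom F z l).
Proof.
move=> s0 /andP[h0 h1] Fs; apply: contrapT => nthick.
(* The gap u between the two dimensions is so small that radii above h lose at
   most a factor 2. *)
have [u [u0 us hu]] : exists u : R, [/\ 0 < u, u <= s & h^-1 `^ u <= 2].
  pose k := (Num.bound h^-1).+1.
  have k0 : 0 < k%:R :> R by rewrite ltr0n.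
  exists (Num.min s k%:R^-1); split.
  - by rewrite lt_min s0 invr_gt0.
  - by rewrite ge_min lexx.
  apply: (@le_trans _ _ (h^-1 `^ k%:R^-1)).
    rewrite ler_powR ?ge_min ?lexx ?orbT// invf_ge1//.
    by apply: (le_trans h1); lra.
  have -> : (2 : R) = (2 `^ k%:R) `^ k%:R^-1.
    by rewrite -powRrM divff ?gt_eqF// powRr1.
  apply: ge0_ler_powR; rewrite ?nnegrE ?powR_ge0 ?invr_ge0 ?(ltW h0)//.
  rewrite powR_mulrn//; apply: (@le_trans _ _ k%:R).
    apply: (@le_trans _ _ (Num.bound h^-1)%:R); last by rewrite ler_nat.
    by apply/ltW/archi_boundP; rewrite invr_ge0 ltW.
  by rewrite -natrX ler_nat; exact/ltnW/ltn_expl.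
apply: (Fs (s - u)); [by rewrite subr_ge0|by rewrite ltrBlDr ltrDl|].
apply: (@assouad_exponent_of_balls _ _ _ h) => //.
- by rewrite h0/= (le_trans h1)//; lra.
- by rewrite subr_ge0.
move=> z rho rho0.
have [l [lh cov suml]] : exists l : seq ('rV[R]_n * R),
    [/\ forall c, c \in l -> h <= c.2 <= 2^-1,
        forall y, zoom F z rho y -> balls l y & \sum_(c <- l) c.2 `^ s < 2^-1].
  apply: contrapT => nl; apply: nthick; exists z, rho; split => // l lh cov.
  by rewrite leNgt; apply/negP => suml; apply: nl; exists l.
exists [seq (z + rho *: c.1, rho * c.2) | c <- l]; split.
- move=> _ /mapP[c /lh /andP[c1 c2] ->] /=.
  by rewrite mulrC !ler_pM2l// c1.
- move=> y Fy zy; pose y' := rho^-1 *: (y - z).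
  have yE : y = z + rho *: y' by rewrite scalerA divff ?gt_eqF// scale1r addrC subrK.
  have /cov/hasP[c cl cy] : zoom F z rho y'.
    split; last by rewrite -yE.
    rewrite enormZ gtr0_norm ?invr_gt0// ler_pdivrMl// mulr1.
    by move: zy; rewrite eucl_distC.
  apply/hasP; exists (z + rho *: c.1, rho * c.2); first exact: map_f.
  by rewrite /= yE eucl_dist_affine// ler_pM2l.
- rewrite big_map.
  apply: (@le_trans _ _ (rho `^ (s - u) * (2 * \sum_(c <- l) c.2 `^ s))).
    rewrite !mulr_sumr big_seq [leRHS]big_seq; apply: ler_sum => c /lh /andP[c1 c2].
    have c0 : 0 < c.2 by exact: lt_le_trans c1.
    rewrite powRM ?(ltW rho0) ?(ltW c0)// ler_pM2l ?powR_gt0//.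
    rewrite powRB ?(gt_eqF c0) ?implybT// mulrC ler_pM2r ?powR_gt0//.
    apply: le_trans hu; rewrite -(powR_inv1 (ltW h0)) -powRrM mulN1r powRN.
    rewrite lef_pV2 ?posrE ?powR_gt0//.
    by apply: ge0_ler_powR; rewrite ?nnegrE// ltW.
  rewrite -[leRHS]mulr1 ler_pM2l ?powR_gt0//; lra.
Qed.

(** Thickness at finer and finer scales is a statement about finite covers, so it
    passes to a limit of enlargements of F and gives it positive content; this is
    a form of a theorem of Furstenberg. *)
Lemma exists_thick_tangent (s : R) F : 0 < s ->
  (forall t : R, 0 <= t -> t < s -> ~ assouad_exponent eucl_dist F t) ->
  exists W, affinely_tangent W F /\ hcontent eucl_dist s W != 0%E.
Proof.
move=> s0 Fs.
pose S (j : nat) : set (set 'rV[R]_n) := [set K | exists z l,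
  [/\ 0 < l, K = zoom F z l & thick_at_scale s j.+2%:R^-1 K]].
have [||h hP] := @matches_cluster R n S.
- move=> j; have [|z [l [l0 lt]]] := @thick_zoom s j.+2%:R^-1 F s0 _ Fs.
    by rewrite invr_gt0 ltr0n/= lef_pV2 ?posrE// ler_nat.
  by exists (zoom F z l), z, l.
- move=> i j ij K [z [l [l0 -> lt]]]; exists z, l; split => // b bl.
  apply: lt => c /bl /andP[b1 b2]; rewrite b2 andbT; apply: le_trans b1.
  by rewrite lef_pV2 ?posrE// ler_nat.
exists (set_limit h); split.
  apply: set_limit_tangent => i; have [K [z [l [l0 -> _]]] m] := hP i 0%N.
  by exists z, l, (zoom F z l); split => // p.
apply/negP => /eqP h0.
(* The first bound keeps the total cost below one half; the second one makes
   each radius at most one half. *)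
pose e : R := Num.min 4^-1 (2^-1 `^ s).
have e0 : 0 < e by rewrite lt_min invr_gt0 ltr0n/= powR_gt0// invr_gt0.
have [c [r [m [r0 re sumr cov]]]] := null_set_limit h0 e0.
have r2 k : r k <= 2^-1.
  rewrite leNgt; apply/negP => /(gt0_ltr_powR s0).
  rewrite !nnegrE => /(_ _ (ltW (r0 k))); rewrite invr_ge0 => /(_ (ler0n _ _)).
  by rewrite ltNge (le_trans (re k))// ge_min lexx orbT.
pose j := \max_(k < m) Num.bound (r k)^-1.
have rj k : (k < m)%N -> j.+2%:R^-1 <= r k.
  move=> km; rewrite -[leRHS]invrK lef_pV2 ?posrE ?invr_gt0//.
  apply: (@le_trans _ _ (Num.bound (r k)^-1)%:R).
    by apply/ltW/archi_boundP; rewrite invr_ge0 ltW.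
  rewrite ler_nat; apply: (@leq_trans j); last by rewrite -addn2 leq_addr.
  exact: (@leq_bigmax _ (fun k : 'I_m => Num.bound (r k)^-1) (Ordinal km)).
have [K [z [l [l0 KE Kt]]] Km] := hP m j.
have := Kt [seq (c k, r k) | k <- iota 0 m].
rewrite big_map => H.
have : 2^-1 <= e.
  apply: le_trans (H _ _) _.
  - by move=> _ /mapP[k + ->] /=; rewrite mem_iota => km; rewrite rj ?r2.
  - move=> y Ky; have [|k km ky] := cov K _ Km y Ky.
      by rewrite KE; exact: zoom_cube.
    apply/hasP; exists (c k, r k); first by apply: map_f; rewrite mem_iota.
    exact: ltW.
  - by move: sumr; rewrite /index_iota subn0.
by rewrite leNgt => /negP; apply; rewrite gt_min; apply/orP; left; lra.
Qed.

End ScaleInvariance.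

(** * A microtangent common to many points *)

Section CommonMicrotangent.
Context {R : realType} {n : nat} (s : R) (W : set 'rV[R]_n).
Hypothesis s0 : 0 < s.
Hypothesis W0 : hcontent eucl_dist s W != 0%E.
Implicit Types (x y z p : 'rV[R]_n) (u : seq bool).
Local Notation hcontent := (hcontent (@eucl_dist R n) s).

(** A bound from below by a fixed proportion of the largest possible order of
    magnitude, invariant under rescaling. *)
Definition thick_in z (l : R) :=
  ((2^-1 * l `^ s)%:E <= hcontent (W `&` eball z l))%E.

(** The points near which arbitrarily small balls carry much of W, with an
    enlargement of W there that has the pattern u. *)
Definition sees u : set 'rV[R]_n := [set y | W y /\
  forall e : R, 0 < e -> exists z (l : R), [/\ 0 < l, l < e,
    eucl_dist z y < e, thick_in z l & matches u (zoom W z l)]].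

(** The points of W near which all balls of radius below 1/(k+1) are thin form a
    null set, since a set of positive content has thick balls at all scales. *)
Lemma hcontent_sees_nil : hcontent (sees [::]) != 0%E.
Proof.
apply/negP => /eqP V0; move/negP: W0; apply; apply/eqP.
pose A k : set 'rV[R]_n := [set y | W y /\
  forall z (l : R), 0 < l -> l < k.+1%:R^-1 -> eucl_dist z y < k.+1%:R^-1 ->
    ~ thick_in z l].
have A0 k : hcontent (A k) = 0%E.
  apply/eqP/negPn/negP => Ak0.
  have k0 : 0 < k.+2%:R^-1 :> R by rewrite invr_gt0.
  have kk : k.+2%:R^-1 < k.+1%:R^-1 :> R by rewrite ltf_pV2 ?posrE// ltr_nat.
  have [z [l [l0 lk Azl]]] := thick_ball s0 Ak0 k0.
  have [[y [[Wy Ay] zy]]|] := pselect (A k `&` eball z l !=set0).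
    apply: (Ay z l) => //; first exact: le_lt_trans kk.
      by apply: le_lt_trans kk; apply: le_trans lk.
    apply: le_trans Azl _; apply: le_hcontent => x [[Wx _] ?]; split => //.
  move=> /set0P/negP/negPn/eqP E; move: Azl; rewrite E hcontent0// lee_fin.
  by rewrite leNgt mulr_gt0// ?invr_gt0// powR_gt0.
apply/eqP; rewrite eq_le hcontent_ge0 andbT.
(* Under the hypothesis that sees [::] is null, it is one more null piece. *)
pose B k := if k is j.+1 then A j else sees [::].
have <- : hcontent (\bigcup_k B k) = 0%E.
  by apply: hcontent_null_bigcup => -[|k] /=; [exact: V0|exact: A0].
apply: le_hcontent => y Wy.
have [|nV] := pselect (sees [::] y); first by exists 0%N.
have /existsNP[e /not_implyP[e0 nz]] : ~ (forall e : R, 0 < e ->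
    exists z (l : R), [/\ 0 < l, l < e, eucl_dist z y < e, thick_in z l &
                          matches [::] (zoom W z l)]).
  by move=> H; apply: nV.
exists (Num.bound e^-1).+1 => //; split => // z l l0 lk zk th; apply: nz.
have ke : (Num.bound e^-1).+1%:R^-1 <= e.
  rewrite -[leRHS]invrK lef_pV2 ?posrE ?invr_gt0//.
  apply: (@le_trans _ _ (Num.bound e^-1)%:R); last by rewrite ler_nat.
  by apply/ltW/archi_boundP; rewrite invr_ge0 ltW.
exists z, l; split => //; first exact: lt_le_trans ke.
exact: lt_le_trans ke.
Qed.

(** Each ball that shows u answers the next question, and one of the two answers
    recurs at arbitrarily small scales. *)
Lemma sees_split u : sees u `<=` sees (rcons u true) `|` sees (rcons u false).
Proof.
move=> y [Wy uy]; apply: contrapT => /not_orP[nt nf].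
have nb b : ~ sees (rcons u b) y -> exists2 e : R, 0 < e &
    forall z (l : R), 0 < l -> l < e -> eucl_dist z y < e -> thick_in z l ->
      ~ matches (rcons u b) (zoom W z l).
  move=> nV; apply: contrapT => ne; apply: nV; split => // e e0.
  apply: contrapT => nz; apply: ne; exists e => // z l l0 le zy th m.
  by apply: nz; exists z, l.
have [e1 e10 h1] := nb _ nt; have [e2 e20 h2] := nb _ nf.
have [|z [l [l0]]] := uy (Num.min e1 e2); first by rewrite lt_min e10.
rewrite !lt_min => /andP[l1 l2] /andP[z1 z2] th m.
case mb : (hits (zoom W z l) (size u)).
- by apply: (h1 z l) => //; exact: matches_rcons.
- by apply: (h2 z l) => //; exact: matches_rcons.
Qed.

(** Null sets form a sigma-ideal, so along one infinite branch of patterns the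
    points that see every finite stage carry positive content. *)
Lemma sees_branch : exists h : nat -> bool,
  forall i, hcontent (sees (mkseq h i)) != 0%E.
Proof.
apply: (@bool_branch (fun u => hcontent (sees u) != 0%E)).
  exact: hcontent_sees_nil.
move=> u u0; apply: contrapT => /forallNP nb.
have b0 b : hcontent (sees (rcons u b)) = 0%E.
  by apply/eqP/negPn/negP; exact: nb.
move/negP: u0; apply; rewrite eq_le hcontent_ge0 andbT.
apply: le_trans (le_hcontent (@sees_split u)) _.
by apply: le_trans (hcontent_setU s0 _ _) _; rewrite !b0 adde0.
Qed.

(** The set P is described by a branch of patterns that are seen from many points,
    and E is a limit of enlargements of the sets of points that see longer and
    longer prefixes. A point of E is thus approximated by points of W that see a
    long prefix, hence a tiny copy of a given finite part of P. *)
Lemma common_microtangent : exists E P : set 'rV[R]_n,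
  [/\ hcontent E != 0%E /\ E `<=` @cube R n,
      hcontent P != 0%E /\ P `<=` @cube R n,
      affinely_tangent E W, affinely_tangent P W &
      forall x y k (p : 'I_k -> 'rV[R]_n) (e : R),
        E x -> E y -> (forall i, P (p i)) -> 0 < e ->
        exists z (l : R) x' z' (l' : R) (q : 'I_k -> 'rV[R]_n),
          [/\ 0 < l, 0 < l' & l' <= l * e] /\
          [/\ W x', eucl_dist (z + l *: x) x' <= l * e,
              eucl_dist (z + l *: y) z' <= l * e &
              forall i, W (q i) /\ eucl_dist (z' + l' *: p i) (q i) <= l' * e]].
Proof.
have [h hV] := sees_branch.
pose V i := sees (mkseq h i).
have V_ne i : V i !=set0.
  by apply/set0P/negP => /eqP E; move/eqP: (hV i); apply; rewrite -/(V i) E hcontent0.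
have VW i : V i `<=` W by move=> y [].
have zoomV i y (e : R) : V i y -> 0 < e -> exists z (l : R),
    [/\ 0 < l, l < e, eucl_dist z y < e, (2^-1%:E <= hcontent (zoom W z l))%E &
        matches (mkseq h i) (zoom W z l)].
  move=> [_ Vy] /Vy[z [l [l0 le zy th m]]]; exists z, l; split => //.
  exact: hcontent_zoom.
pose S (j : nat) : set (set 'rV[R]_n) := [set K | exists i z (l : R),
  [/\ (j <= i)%N, 0 < l, K = zoom (V i) z l & (2^-1%:E <= hcontent K)%E]].
have [||g gP] := @matches_cluster R n S.
- move=> j; have [z [l [l0 _ th]]] := thick_ball s0 (hV j) ltr01.
  exists (zoom (V j) z l), j, z, l; split => //.
  exact: hcontent_zoom.
- move=> i j ij K [i' [z [l [ji' l0 -> th]]]]; exists i', z, l; split => //.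
  exact: leq_trans ji'.
have i20 : 0 < 2^-1 :> R by rewrite invr_gt0.
exists (set_limit g), (set_limit h); split.
- split; last by move=> y [].
  apply: (hcontent_set_limit s0 i20) => i.
  have [K [i' [z [l [_ _ KE th]]]] m] := gP i 0%N.
  by exists K; split => //; rewrite KE; exact: zoom_cube.
- split; last by move=> y [].
  apply: (hcontent_set_limit s0 i20) => i.
  have [y Vy] := V_ne i; have [z [l [l0 _ _ th m]]] := zoomV i y 1 Vy ltr01.
  by exists (zoom W z l); split => //; exact: zoom_cube.
- apply: set_limit_tangent => i.
  have [K [i' [z [l [_ l0 KE th]]]] m] := gP i 0%N.
  by exists z, l, K; split => //; rewrite KE => p [p1 /VW].
- apply: set_limit_tangent => i.
  have [y Vy] := V_ne i; have [z [l [l0 _ _ th m]]] := zoomV i y 1 Vy ltr01.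
  by exists z, l, (zoom W z l); split => // p.
move=> x y k p e Ex Ey Pp e0.
have [i1 near1] := set_limit_near e0 Pp.
have e20 : 0 < e / 2 by rewrite divr_gt0.
have [|i2 near2] := @set_limit_near _ _ g 2
    (fun b : 'I_2 => if b == ord0 then x else y) _ e20.
  by move=> b; case: ifP.
have [K [i [z [l [i1i l0 KE th]]]] m] := gP i2 i1.
have [x' + xx'] := near2 K m ord0; have [y' + yy'] := near2 K m ord_max.
rewrite KE => -[_ Vy'] [_ Vx'].
have le0 : 0 < l * (e / 2) by rewrite mulr_gt0.
have [z' [l' [l'0 l'e zy' _ m']]] := zoomV _ _ _ Vy' le0.
have /choice[q qP] : forall j, exists q, zoom W z' l' q /\ eucl_dist (p j) q < e.
  move=> j; have [|q ? ?] := near1 (zoom W z' l') _ j; last by exists q.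
  exact: matches_le m'.
exists z, l, (z + l *: x'), z', l', (fun j => z' + l' *: q j); split; split => //.
- by apply: le_trans (ltW l'e) _; rewrite ler_pM2l//; lra.
- exact: VW Vx'.
- by rewrite eucl_dist_affine// ler_pM2l// (le_trans (ltW xx'))//; lra.
- apply: le_trans (eucl_dist_triangle _ (z + l *: y') _) _.
  rewrite eucl_dist_affine// (eucl_distC _ z').
  have : l * eucl_dist y y' <= l * (e / 2) by rewrite ler_pM2l// ltW.
  by move: zy'; lra.
- move=> j; split; first exact: (qP j).1.2.
  by rewrite eucl_dist_affine// ler_pM2l// ltW// (qP j).2.
Qed.

End CommonMicrotangent.

(** * Norms with a smooth sphere *)

Section GaussMap.
Context {R : realType} {n : nat} (N : 'rV[R]_n -> R).
Hypothesis hN : is_norm N.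
Implicit Types (x y h u v w e nu : 'rV[R]_n) (t : R).

Lemma is_norm_scale t x : N (t *: x) = `|t| * N x.
Proof. by case: hN. Qed.

Lemma is_norm_add x y : N (x + y) <= N x + N y.
Proof. by case: hN. Qed.

Lemma is_norm0 : N 0 = 0.
Proof. by rewrite -(scale0r 0) is_norm_scale normr0 mul0r. Qed.

Lemma is_normN x : N (- x) = N x.
Proof. by rewrite -scaleN1r is_norm_scale normrN1 mul1r. Qed.

Lemma is_norm_ge0 x : 0 <= N x.
Proof. by have := is_norm_add x (- x); rewrite subrr is_norm0 is_normN; lra. Qed.

Lemma is_norm_gt0 x : x != 0 -> 0 < N x.
Proof.
move=> x0; rewrite lt_neqAle is_norm_ge0 andbT eq_sym.
by apply: contraNN x0 => /eqP; case: hN => h _ _ /h ->.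
Qed.

Lemma is_norm_le : exists2 C : R, 0 < C & forall x, N x <= C * enorm x.
Proof.
pose C := \sum_i N (delta_mx 0 i : 'rV[R]_n).
exists (C + 1); first by rewrite ltr_wpDl// sumr_ge0// => i _; exact: is_norm_ge0.
move=> x; rewrite mulrDl mul1r -[leLHS]addr0 lerD ?enorm_ge0//.
rewrite [in leLHS](row_sum_delta x) mulr_suml.
elim/big_ind2 : _ => [|a b c d ab cd|i _]; first by rewrite is_norm0.
  by apply: le_trans (is_norm_add _ _) _; exact: lerD.
rewrite is_norm_scale mulrC ler_wpM2l ?is_norm_ge0//.
exact: enorm_coord.
Qed.

Lemma is_norm_dist x y : `|N x - N y| <= N (x - y).
Proof.
rewrite ler_norml; have := is_norm_add (x - y) y; have := is_norm_add (y - x) x.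
by rewrite !subrK -(is_normN (y - x)) opprB => *; apply/andP; split; lra.
Qed.

Lemma near_enorm x (P : set 'rV[R]_n) : nbhs x P <->
  exists2 d : R, 0 < d & forall y, enorm (y - x) < d -> P y.
Proof.
split=> [/nbhs_ballP[d /= d0 dP]|[d d0 dP]].
  exists d => // y yd; apply: dP; rewrite -ball_normE /= distrC.
  exact: le_lt_trans (norm_le_enorm _) yd.
rewrite nbhsE; exists [set y | eucl_dist x y < d].
  by split; [exact: open_eucl_ball|rewrite /= eucl_distxx].
by move=> y /= xy; apply: dP; rewrite -/(eucl_dist y x) eucl_distC.
Qed.

(** Norms are continuous, and the points of norm 1 are limits of points of larger
    norm on the same ray. *)
Lemma boundary_unit_ball x : boundary (unit_ball N) x <-> N x = 1.
Proof.
have [C C0 NC] := is_norm_le.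
split=> [[clx intx]|Nx].
  apply/eqP; rewrite eq_le; apply/andP; split.
    rewrite leNgt; apply/negP => Nx.
    have [|y [By xy]] := clx [set y | 1 < N y].
      apply/near_enorm; exists ((N x - 1) / C); first by rewrite divr_gt0// subr_gt0.
      move=> y; rewrite ltr_pdivlMr// mulrC => xy /=.
      have := is_norm_dist x y; rewrite -(opprB y x) is_normN ler_norml => /andP[_].
      by have := NC (y - x); lra.
    by move: By; rewrite /unit_ball /= leNgt => /negP.
  rewrite leNgt; apply/negP => Nx; apply: intx; rewrite /interior.
  apply/near_enorm; exists ((1 - N x) / C); first by rewrite divr_gt0// subr_gt0.
  move=> y; rewrite ltr_pdivlMr// mulrC /unit_ball /= => xy.
  have := is_norm_dist y x; rewrite ler_norml => /andP[_].
  by have := NC (y - x); lra.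
split; first by apply: subset_closure; rewrite /unit_ball /= Nx.
move=> /near_enorm[d d0 dP].
pose t := d / (2 * (enorm x + 1)).
have E0 := enorm_ge0 x.
have t0 : 0 < t by rewrite divr_gt0// mulr_gt0// ltr_wpDl.
have : unit_ball N ((1 + t) *: x).
  apply: dP; rewrite scalerDl scale1r addrC addrA addNr add0r enormZ gtr0_norm//.
  rewrite /t mulrAC ltr_pdivrMr; last by rewrite mulr_gt0// ltr_wpDl.
  by rewrite ltr_pM2l//; lra.
rewrite /unit_ball /= is_norm_scale Nx gtr0_norm; lra.
Qed.

Definition has_gradient e v := forall c : R, 0 < c -> exists2 d : R, 0 < d &
  forall h, enorm h < d -> `|N (e + h) - N e - dotp v h| <= c * enorm h.

Lemma linear_dotp (f : {linear 'rV[R]_n -> R^o}) :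
  exists v, forall h, f h = dotp v h.
Proof.
exists (\row_i f (delta_mx 0 i)) => h.
rewrite [in LHS](row_sum_delta h) linear_sum; apply: eq_bigr => i _.
by rewrite linearZ /= mxE mulrC.
Qed.

Lemma dotp_small v w : (forall c : R, 0 < c -> `|dotp v w| <= c) -> dotp v w = 0.
Proof.
move=> small; apply/eqP/negPn/negP => vw0.
have p : 0 < `|dotp v w| by rewrite normr_gt0.
by have := small (`|dotp v w| / 2); rewrite divr_gt0// => /(_ isT); lra.
Qed.

(** Let f define the sphere near e, with differential given by b. Projecting e + h
    radially to the sphere gives a zero of f, so dotp b h and
    (N (e + h) - 1) * dotp b e differ by o(h). If dotp b e were zero, b would be
    zero as well; hence N is differentiable at e, with gradient proportional to
    b. *)
Lemma gradient_exists e : N e = 1 -> C1_hypersurface (boundary (unit_ball N)) ->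
  exists v, has_gradient e v.
Proof.
move=> Ne /(_ e ((boundary_unit_ball e).2 Ne))[U [f [oU Ue C1 ndf bU]]].
have [C C0 NC] := is_norm_le.
have [df _] := C1 e Ue.
have [b bE] : exists b, forall h, 'd f e h = dotp b h by exact: linear_dotp.
have b0 : b != 0.
  have [v dv] := ndf e Ue; apply: contraNneq dv => bz; apply/eqP.
  exact: (etrans (bE v) (etrans (congr1 (dotp^~ v) bz) (dotp0l v))).
have fe : f e = 0.
  have : (boundary (unit_ball N) `&` U) e.
    by split => //; exact/boundary_unit_ball.
  by rewrite bU => -[].
have fdiff (c : R) : 0 < c -> exists2 d : R, 0 < d &
    forall h, enorm h < d -> U (e + h) /\
      `|f (e + h) - dotp b h| <= c * enorm h.
  move=> c0.
  have /eqaddoP /(_ c c0) /near_enorm[d d0 dP] := diff_locally df.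
  have /near_enorm[d' d'0 d'P] : nbhs e U by exact: open_nbhs_nbhs.
  exists (Num.min d d'); first by rewrite lt_min d0.
  move=> h; rewrite lt_min => /andP[hd hd']; split.
    by apply: d'P; rewrite addrAC subrr add0r.
  have := dP h; rewrite subr0 => /(_ hd).
  have -> : (f \o shift e - (cst (f e) + 'd f e)) h = f (e + h) - dotp b h.
    transitivity (f (h + e) - (f e + 'd f e h)); first by [].
    by rewrite -bE fe add0r [h + e]addrC.
  move=> /le_trans; apply.
  by rewrite ler_wpM2l ?norm_le_enorm// ltW.
have key (c : R) : 0 < c -> exists2 d : R, 0 < d & forall h, enorm h < d ->
    `|dotp b h - (N (e + h) - 1) * dotp b e| <= c * enorm h.
  move=> c0; pose M := 1 + C * enorm e.
  have M0 : 0 < M by rewrite ltr_pwDl// mulr_ge0 ?enorm_ge0// ltW.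
  have [d d0 dP] := fdiff (c / M) (divr_gt0 c0 M0).
  pose d' := Num.min (C * 2)^-1 (d / (2 * M)).
  exists d'; first by rewrite lt_min invr_gt0 divr_gt0 ?mulr_gt0.
  move=> h; rewrite lt_min => /andP[h1 h2].
  pose m := N (e + h) - 1; rewrite -/m.
  have mh : `|m| <= C * enorm h.
    have := is_norm_dist (e + h) e; rewrite Ne addrAC subrr add0r.
    by move=> /le_trans; apply.
  have Ch : C * enorm h < 2^-1.
    by move: h1; rewrite invfM mulrC ltr_pdivlMr// mulrC.
  have NE : N (e + h) = 1 + m by rewrite /m; lra.
  have m1 : 2^-1 < 1 + m by move: mh; rewrite ler_norml => /andP[? _]; lra.
  pose l := (1 + m)^-1.
  have m10 : 0 < 1 + m by lra.
  have l0 : 0 < l by rewrite invr_gt0.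
  have l2 : l <= 2 by rewrite /l -[leRHS]invrK lef_pV2 ?posrE ?invr_gt0// ltW.
  pose k := h - m *: e.
  have kM : enorm k <= M * enorm h.
    apply: le_trans (enormD _ _) _; rewrite enormN enormZ.
    have := ler_wpM2r (enorm_ge0 e) mh; rewrite /M; lra.
  have [|U1 f1] := dP (l *: k).
    rewrite enormZ gtr0_norm//; move: h2; rewrite ltr_pdivlMr ?mulr_gt0// => h2.
    have := ler_wpM2r (enorm_ge0 k) l2; lra.
  have yE : e + l *: k = l *: (e + h).
    have {1}-> : e = l *: ((1 + m) *: e).
      by rewrite scalerA mulVf ?scale1r// gt_eqF.
    rewrite -scalerDr /k scalerDl scale1r; congr (_ *: _).
    by rewrite -addrA [m *: e + _]addrC subrK.
  have fy : f (e + l *: k) = 0.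
    have : (boundary (unit_ball N) `&` U) (e + l *: k).
      split => //; apply/boundary_unit_ball.
      by rewrite yE is_norm_scale gtr0_norm// NE mulVf// gt_eqF.
    by rewrite bU => -[].
  move: f1; rewrite fy sub0r normrN dotpZr enormZ normrM gtr0_norm//.
  rewrite mulrCA ler_pM2l// dotpBr dotpZr => /le_trans; apply.
  by rewrite mulrAC ler_pdivrMr// -mulrA [X in _ <= _ * X]mulrC ler_pM2l.
have c0 : dotp b e != 0.
  apply/negP => /eqP be0; move/eqP: b0; apply; apply: dotp_eq0.
  have eb := enorm_ge0 b.
  apply: dotp_small => c cp.
  have b10 : 0 < enorm b + 1 by lra.
  have [d d0 dP] := key (c / (enorm b + 1)) (divr_gt0 cp b10).
  pose t := d / (2 * (enorm b + 1)).
  have t0 : 0 < t by rewrite divr_gt0// mulr_gt0.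
  have := dP (t *: b); rewrite be0 mulr0 subr0 dotpZr normrM enormZ gtr0_norm//.
  rewrite mulrCA ler_pM2l// => H; apply: le_trans (H _) _.
    by rewrite /t mulrAC ltr_pdivrMr ?mulr_gt0// ltr_pM2l//; lra.
  by rewrite mulrAC ler_pdivrMr// ler_pM2l//; lra.
pose a := (dotp b e)^-1 *: b.
exists a => c cp.
have p : 0 < `|dotp b e| by rewrite normr_gt0.
have [d d0 dP] := key (c * `|dotp b e|) (mulr_gt0 cp p).
exists d => // h /dP.
rewrite Ne dotpZl -{1}[dotp b h](divfK c0) -mulrBl normrM mulrAC ler_pM2r//.
by rewrite mulrC distrC.
Qed.

(** Euler's relation for a function that is homogeneous of degree 1. *)
Lemma gradient_euler e v : N e = 1 -> has_gradient e v -> dotp v e = 1.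
Proof.
move=> Ne gv; apply/eqP; rewrite -subr_eq0; apply/eqP.
have E0 := enorm_ge0 e.
have E1 : 0 < enorm e + 1 by lra.
apply/eqP/negPn/negP => ne.
have p : 0 < `|dotp v e - 1| by rewrite normr_gt0.
pose c := `|dotp v e - 1| / (2 * (enorm e + 1)).
have c0 : 0 < c by rewrite divr_gt0// mulr_gt0.
have [d d0 dP] := gv c c0.
pose t := d / (2 * (enorm e + 1)).
have t0 : 0 < t by rewrite divr_gt0// mulr_gt0.
have := dP (t *: e); rewrite enormZ gtr0_norm// => H.
have {}H : `|N (e + t *: e) - N e - dotp v (t *: e)| <= c * (t * enorm e).
  by apply: H; rewrite /t mulrAC ltr_pdivrMr ?mulr_gt0// ltr_pM2l//; lra.
move: H; rewrite -{1}[e]scale1r -scalerDl is_norm_scale Ne mulr1 dotpZr.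
have -> : `|1 + t| = 1 + t by rewrite gtr0_norm//; lra.
have -> : 1 + t - 1 - t * dotp v e = - (t * (dotp v e - 1)) by ring.
rewrite normrN normrM gtr0_norm// mulrCA ler_pM2l// /c mulrAC.
rewrite ler_pdivlMr ?mulr_gt0// ler_pM2l//; lra.
Qed.

(** The norm is constant along curves in the sphere, and it increases in the
    direction of its gradient. *)
Lemma has_gradient_outward_normal e v : N e = 1 -> has_gradient e v ->
  outward_unit_normal (unit_ball N) e ((enorm v)^-1 *: v).
Proof.
move=> Ne gv; have ve := gradient_euler Ne gv.
have v0 : v != 0 by apply/eqP => v0; move/eqP: ve; rewrite v0 dotp0l eq_sym oner_eq0.
have vp := enorm_gt0 v0.
split.
- by rewrite enormZ gtr0_norm ?invr_gt0// mulVf// gt_eqF.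
- move=> w [g [g0 gN [gd gw]]]; rewrite dotpZl.
  suff -> : dotp v w = 0 by rewrite mulr0.
  apply: dotp_small => c c0.
  have wE := enorm_ge0 w.
  pose c1 := c / (2 * (enorm w + 1)).
  pose c2 := Num.min 1 (c / (2 * enorm v * n.+1%:R)).
  have c10 : 0 < c1 by rewrite divr_gt0// mulr_gt0//; lra.
  have c20 : 0 < c2 by rewrite lt_min ltr01 divr_gt0// !mulr_gt0.
  have [d d0 dP] := gv c1 c10.
  have cvg_w : (fun t : R => t^-1 *: ((g \o shift 0) (t *: (1 : R)) - g 0)) @ 0^' --> w.
    by rewrite -gw; exact: gd.
  have near_w : \forall t \near (0 : R)^', enorm
      (t^-1 *: ((g \o shift 0) (t *: (1 : R)) - g 0) - w) < c2.
    by apply: (cvg_w [set y | enorm (y - w) < c2]); apply/near_enorm; exists c2.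
  have near_g : \forall t \near (0 : R)^', N (g t) = 1.
    apply: (@cvg_within _ (nbhs (0 : R)) _ _ _).
    by apply: filterS gN => t /boundary_unit_ball.
  have near_t : \forall t \near (0 : R)^', `|t| * (enorm w + 1) < d /\ t != 0.
    have t0 : \forall t \near (0 : R)^', t != 0 by exact: nbhs_dnbhs_neq.
    apply: filterI; last exact: t0.
    apply: (@cvg_within _ (nbhs (0 : R)) _ _ _).
    apply/nbhs_ballP; exists (d / (enorm w + 1)) => /=; first by rewrite divr_gt0//; lra.
    move=> t; rewrite -ball_normE /= sub0r normrN => td.
    by rewrite -ltr_pdivlMr//; lra.
  have [t [[tw tg] [td t0]]] := filter_ex (filterI (filterI near_w near_g) near_t).
  move: tw; rewrite /= addr0 [t *: 1]mulr1 g0 => tw.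
  have tp : 0 < `|t| by rewrite normr_gt0.
  pose r := t^-1 *: (g t - e) - w.
  have rE : g t = e + t *: (w + r).
    by rewrite /r [w + _]addrC subrK scalerA divff// scale1r [e + _]addrC subrK.
  have r2 : enorm r < c2 by [].
  have r1 : enorm r < 1 by apply: lt_le_trans r2 _; rewrite ge_min lexx.
  have wr : enorm (w + r) <= enorm w + 1.
    by apply: le_trans (enormD _ _) _; lra.
  have := dP (t *: (w + r)); rewrite -rE tg Ne subrr sub0r normrN enormZ.
  rewrite dotpZr normrM mulrCA ler_pM2l// => H.
  have {}H : `|dotp v (w + r)| <= c1 * enorm (w + r).
    by apply: H; apply: le_lt_trans td; rewrite ler_pM2l.
  have H1 : c1 * enorm (w + r) <= c / 2.
    apply: (@le_trans _ _ (c1 * (enorm w + 1))); first by rewrite ler_pM2l.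
    by rewrite /c1 invfM mulrA mulfVK//; lra.
  have H2 : `|dotp v r| <= c / 2.
    apply: le_trans (dotp_norm_le _ _) _.
    have r3 : enorm r <= c / (2 * enorm v).
      apply/ltW/(lt_le_trans r2); rewrite ge_min; apply/orP; right.
      rewrite ler_pM2l// lef_pV2 ?posrE ?mulr_gt0// ler_peMr ?ler1n//.
      by rewrite mulr_ge0// ltW.
    have := ler_wpM2l (ltW vp) r3.
    by rewrite invfM [c * _]mulrA mulrCA mulfV ?gt_eqF// mulr1.
  have -> : dotp v w = dotp v (w + r) - dotp v r by rewrite -dotpBr addrK.
  by apply: le_trans (ler_normB _ _) _; lra.
- have [|d d0 dP] := gv (enorm v / 2); first by rewrite divr_gt0.
  near=> t; rewrite /unit_ball /=; apply/negP; rewrite -ltNge.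
  have t0 : 0 < t by near: t; exact: nbhs_right_gt.
  have td : t < d by near: t; exact: nbhs_right_lt.
  have nE : enorm (t *: ((enorm v)^-1 *: v)) = t.
    by rewrite !enormZ !gtr0_norm ?invr_gt0// mulVf ?mulr1// gt_eqF.
  have := dP _ (eq_ind_r (fun a : R => a < d) td nE).
  rewrite nE Ne !dotpZr -enorm_sqr expr2 mulKf ?gt_eqF//.
  rewrite ler_norml => /andP[+ _]; have := mulr_gt0 t0 vp; lra.
Unshelve. all: by end_near. Qed.

(** The curve obtained by projecting a tangent line radially to the sphere has
    the direction of that line as velocity. *)
Lemma gradient_kernel_tangent e v w : N e = 1 -> has_gradient e v ->
  dotp v w = 0 -> tangent_vector (boundary (unit_ball N)) e w.
Proof.
move=> Ne gv vw0; have [C C0 NC] := is_norm_le.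
exists (fun t => (N (e + t *: w))^-1 *: (e + t *: w)).
have Npos t : `|t| * (C * (enorm w + 1)) < 2^-1 -> 2^-1 < N (e + t *: w).
  move=> tC; have := is_norm_dist (e + t *: w) e.
  rewrite Ne addrAC subrr add0r ler_norml => /andP[+ _].
  have := NC (t *: w); rewrite enormZ => h1.
  have : `|t| * (C * enorm w) <= `|t| * (C * (enorm w + 1)).
    by rewrite ler_wpM2l// ler_wpM2l ?(ltW C0)//; lra.
  lra.
have wE := enorm_ge0 w; have eE := enorm_ge0 e.
have M0 : 0 < C * (enorm w + 1) by rewrite mulr_gt0//; lra.
have smallN (d : R) : 0 < d -> \forall t \near (0 : R), `|t| < d.
  move=> d0; apply/nbhs_ballP; exists d => //= t.
  by rewrite -ball_normE /= sub0r normrN.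
have near_pos : \forall t \near (0 : R), 2^-1 < N (e + t *: w).
  have := smallN (2^-1 / (C * (enorm w + 1))); rewrite divr_gt0 ?invr_gt0// => /(_ isT).
  by apply: filterS => t; rewrite ltr_pdivlMr// => /Npos.
split.
- by rewrite scale0r addr0 Ne invr1 scale1r.
- apply: filterS near_pos => t tpos; apply/boundary_unit_ball.
  have h : 0 < N (e + t *: w) by apply: lt_trans tpos; rewrite invr_gt0.
  by rewrite is_norm_scale gtr0_norm ?invr_gt0// mulVf// gt_eqF.
have cvg_w : (fun t : R => t^-1 *: (((fun t => (N (e + t *: w))^-1 *: (e + t *: w))
    \o shift 0) (t *: (1 : R)) - (N (e + 0 *: w))^-1 *: (e + 0 *: w))) @ 0^' --> w.
  apply/cvgrPdist_le => c c0 /=.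
  pose M := 2 * (enorm w + 1) * (enorm e + enorm w + 1).
  have Mp : 0 < M by rewrite !mulr_gt0//; lra.
  pose c1 := c / M; have c10 : 0 < c1 by exact: divr_gt0.
  have [d d0 dP] := gv c1 c10.
  have w1 : 0 < enorm w + 1 by lra.
  have n1 := nbhs_dnbhs near_pos.
  have n2 := nbhs_dnbhs (smallN _ (divr_gt0 d0 w1)).
  have n3 := nbhs_dnbhs (smallN _ ltr01).
  have n4 : \forall t \near (0 : R)^', t != 0 by exact: nbhs_dnbhs_neq.
  apply: filterS (filterI (filterI n1 n2) (filterI n3 n4)) => t [[t1 t2] [t3 t0]].
  rewrite addr0 [t *: 1]mulr1 scale0r addr0 Ne invr1 scale1r.
  set y := e + t *: w; set m := N y in t1 *.
  have mp : 0 < m by apply: lt_trans t1; rewrite invr_gt0.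
  have tp : 0 < `|t| by rewrite normr_gt0.
  have H : `|m - 1| <= c1 * (`|t| * enorm w).
    have := dP (t *: w); rewrite enormZ Ne dotpZr vw0 mulr0 subr0; apply.
    move: t2; rewrite ltr_pdivlMr// mulrDr mulr1; lra.
  have -> : w - t^-1 *: (m^-1 *: y - e) = (t^-1 * (1 - m^-1)) *: y.
    have {1}-> : w = t^-1 *: (y - e).
      by rewrite /y addrC addrA addNr add0r scalerA mulVf// scale1r.
    by rewrite -scalerBr opprB addrA subrK -scalerA scalerBl scale1r.
  apply: le_trans (norm_le_enorm _) _.
  rewrite enormZ normrM normfV.
  have -> : 1 - m^-1 = m^-1 * (m - 1) by rewrite mulrBr mulVf ?gt_eqF// mulr1.
  rewrite normrM gtr0_norm ?invr_gt0//.
  have m2 : m^-1 <= 2 by rewrite -[leRHS]invrK lef_pV2 ?posrE ?invr_gt0// ltW.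
  have ym : enorm y <= enorm e + enorm w + 1.
    apply: le_trans (enormD _ _) _; rewrite enormZ.
    have : `|t| * enorm w <= 1 * enorm w by rewrite ler_wpM2r// ltW.
    lra.
  rewrite -mulrA ler_pdivrMl//.
  apply: (@le_trans _ _ (2 * (c1 * (`|t| * enorm w)) * (enorm e + enorm w + 1))).
    apply: ler_pM => //; first by rewrite mulr_ge0// invr_ge0 ltW.
      exact: enorm_ge0.
    by apply: ler_pM => //; rewrite invr_ge0 ltW.
  have cE : c = c1 * M by rewrite /c1 divfK// gt_eqF.
  rewrite cE /M.
  have : 0 <= c1 * `|t| * (enorm e + enorm w + 1).
    by rewrite mulr_ge0 ?addr_ge0// mulr_ge0// ltW.
  lra.
apply: DeriveDef.
  by rewrite /derivable; apply/cvg_ex; exists w; exact: cvg_w.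
by rewrite /derive; apply/cvg_lim.
Qed.

(** The kernel of the gradient consists of tangent vectors, so a unit normal is
    proportional to the gradient. *)
Lemma gauss_map_gradient e : N e = 1 ->
  C1_hypersurface (boundary (unit_ball N)) ->
  enorm (gauss_map (unit_ball N) e) = 1 /\
  exists2 k : R, k != 0 & has_gradient e (k *: gauss_map (unit_ball N) e).
Proof.
move=> Ne hC; have [v gv] := gradient_exists Ne hC.
set nu := gauss_map _ e.
have [nu1 nut _] : outward_unit_normal (unit_ball N) e nu.
  exact: (xgetPex 0 (ex_intro _ _ (has_gradient_outward_normal Ne gv))).
split => //.
have v0 : v != 0.
  apply/eqP => v0; have := gradient_euler Ne gv.
  by rewrite v0 dotp0l => /esym/eqP; rewrite oner_eq0.
pose w := enorm v ^+ 2 *: nu - dotp nu v *: v.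
have vw : dotp v w = 0.
  by rewrite dotpBr !dotpZr -enorm_sqr (dotpC v nu) mulrC subrr.
have w0 : w = 0.
  apply: dotp_eq0; rewrite {1}/w dotpBl !dotpZl vw mulr0 subr0.
  by rewrite (nut w) ?mulr0//; exact: gradient_kernel_tangent gv vw.
have nuE : enorm v ^+ 2 *: nu = dotp nu v *: v.
  by apply/eqP; rewrite -subr_eq0 -/w w0.
have p : enorm v ^+ 2 != 0 by rewrite expf_neq0// gt_eqF// enorm_gt0.
have q : dotp nu v != 0.
  apply/eqP => q; move: nuE; rewrite q scale0r => /eqP.
  rewrite scaler_eq0 (negbTE p) /= => /eqP nu0.
  by move: nu1; rewrite nu0 enorm0 => /esym/eqP; rewrite oner_eq0.
exists (enorm v ^+ 2 / dotp nu v); first by rewrite mulf_neq0// invr_eq0.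
by rewrite mulrC -scalerA nuE scalerA mulVf// scale1r.
Qed.

(** A convex function that is differentiable at a point is strictly
    differentiable there. *)
Lemma gradient_strict e v w : N e = 1 -> has_gradient e v ->
  w != 0 -> e = (N w)^-1 *: w ->
  forall c : R, 0 < c -> exists2 d : R, 0 < d & forall x y,
    enorm (x - w) < d -> enorm (y - w) < d ->
    `|N x - N y - dotp v (x - y)| <= c * enorm (x - y).
Proof.
move=> Ne gv w0 ew c c0.
have t0 := is_norm_gt0 w0; set t := N w in ew t0.
have wE : w = t *: e by rewrite ew scalerA divff ?scale1r// gt_eqF.
have c40 : 0 < c / 4 by rewrite divr_gt0.
have [d d0 dP] := gv _ c40.
pose G h := N (w + h) - t - dotp v h.
have Gsmall h : enorm h < t * d -> `|G h| <= c / 4 * enorm h.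
  move=> hd; pose h' := t^-1 *: h.
  have hE : h = t *: h' by rewrite scalerA divff ?scale1r// gt_eqF.
  have -> : G h = t * (N (e + h') - N e - dotp v h').
    rewrite /G wE hE -scalerDr is_norm_scale (gtr0_norm t0) dotpZr Ne; ring.
  have h'E : enorm h = t * enorm h' by rewrite hE enormZ gtr0_norm.
  rewrite normrM (gtr0_norm t0) h'E mulrCA ler_pM2l//; apply: dP.
  by rewrite -(ltr_pM2l t0) -h'E.
pose r := t * d / 2.
have r0 : 0 < r by rewrite divr_gt0// mulr_gt0.
(* The increment from k to h is compared with the increment from k to the point
   h' at distance r beyond h on the same line. *)
have half h k : enorm h < r -> enorm k < r -> G h - G k <= c * enorm (h - k).
  move=> hr kr; have [->|hk] := eqVneq h k.
    by rewrite !subrr enorm0 mulr0.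
  have D0 : 0 < enorm (h - k) by rewrite enorm_gt0// subr_eq0.
  set D := enorm (h - k) in D0 *.
  pose h' := h + (r / D) *: (h - k).
  have h'r : enorm h' < t * d.
    apply: le_lt_trans (enormD _ _) _.
    rewrite enormZ (gtr0_norm (divr_gt0 r0 D0)) -/D divfK ?gt_eqF//.
    by move: hr; rewrite /r; lra.
  pose th := D / (D + r).
  have Dr : 0 < D + r by rewrite addr_gt0.
  have th0 : 0 < th by rewrite divr_gt0.
  have th1 : th < 1 by rewrite ltr_pdivrMr// mul1r ltrDl.
  have hE : h = (1 - th) *: k + th *: h'.
    have thE : th * (r / D) = 1 - th.
      by rewrite /th; field; rewrite !gt_eqF.
    rewrite /h' scalerDr scalerA thE scalerBr addrC addrA addrNK -scalerDl.
    by rewrite addrC subrK scale1r.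
  have conv : G h <= (1 - th) * G k + th * G h'.
    have : N (w + h) <= (1 - th) * N (w + k) + th * N (w + h').
      have -> : w + h = (1 - th) *: (w + k) + th *: (w + h').
        rewrite hE !scalerDr addrACA -scalerDl subrK scale1r //.
      apply: le_trans (is_norm_add _ _) _; rewrite !is_norm_scale.
      by rewrite !gtr0_norm ?subr_gt0.
    have : dotp v h = (1 - th) * dotp v k + th * dotp v h'.
      by rewrite {1}hE dotpC dotpDl !dotpZl !(dotpC _ v).
    by rewrite /G => ->; lra.
  have := Gsmall h' h'r; have := Gsmall k; rewrite !ler_norml => Hk /andP[_ Gh'].
  have /andP[Gk _] : - (c / 4 * enorm k) <= G k <= c / 4 * enorm k.
    by apply: Hk; move: kr; rewrite /r; have := mulr_gt0 t0 d0; lra.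
  have b1 : c / 4 * enorm h' <= c / 4 * (t * d) by rewrite ler_pM2l// ltW.
  have b2 : c / 4 * enorm k <= c / 4 * (t * d).
    by rewrite ler_pM2l//; move: kr; rewrite /r; have := mulr_gt0 t0 d0; lra.
  have : th * (G h' - G k) <= th * (c * r).
    by rewrite ler_pM2l// /r; lra.
  have : th * (c * r) <= c * D.
    rewrite /th mulrCA ler_pM2l// mulrAC ler_pdivrMr// ler_pM2l//; lra.
  by move: conv; lra.
exists r => // x y xr yr.
have xE : x = w + (x - w) by rewrite addrC subrK.
have yE : y = w + (y - w) by rewrite addrC subrK.
have E : x - y = (x - w) - (y - w) by rewrite opprB addrA subrK.
have GE : N x - N y - dotp v (x - y) = G (x - w) - G (y - w).
  by rewrite /G -xE -yE E dotpBr; ring.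
rewrite GE ler_norml; apply/andP; split; last by rewrite E half.
have := half (y - w) (x - w) yr xr.
by rewrite (enormB (y - w)) -E; lra.
Qed.

End GaussMap.

(** * Null sets of points and of lines *)

Section NullSets.
Context {R : realType} {n : nat}.
Implicit Types (A F G : set 'rV[R]_n) (x y u v : 'rV[R]_n).

Lemma hcontent_fin_union (q b : R) k (U : 'I_k -> set 'rV[R]_n) A : 0 < q ->
  (forall i, hcontent eucl_dist q (U i) <= b%:E)%E -> A `<=` \bigcup_i U i ->
  (hcontent eucl_dist q A <= (k%:R * b)%:E)%E.
Proof.
move=> q0 Ub AU.
have := hcontent_seq (A := A) q0 (enum 'I_k) (fun=> b%:E) U Ub.
rewrite sumEFin big_const_seq count_predT size_enum_ord iter_addr addr0.
rewrite mulr_natl; apply => y /AU[i _ Uy]; apply/hasP; exists i.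
  by rewrite mem_enum.
exact/asboolP.
Qed.

Lemma hcontent_eq0P (q : R) A : 0 < q ->
  hcontent eucl_dist q A = 0%E <-> small_covers eucl_dist q A.
Proof.
move=> q0; split=> [A0 e e0|cA].
  have [|U [r [r0 Ur AU re]]] := @hcontent_cover _ _ (@eucl_dist R n) q A e%:E.
    by rewrite A0 lte_fin.
  by exists U, r; split => //; exact: ltW.
apply/eqP; rewrite eq_le hcontent_ge0 andbT; apply/lee_addgt0Pr => e e0.
rewrite add0e; have [U [r [r0 Ur AU re]]] := cA e e0.
by apply: le_trans re; exact: (hcontent_cover_le q0 r0 Ur AU).
Qed.

Lemma cube_enorm x : cube x -> enorm x <= n%:R.
Proof.
move=> cx; apply: le_trans (enorm_le_norm _) _.
rewrite -[leRHS]mulr1 ler_wpM2l// [`|_|]mx_normrE.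
apply/bigmax_leP; split => // -[i j] _ /=.
by rewrite ord1; exact: cx.
Qed.

(** For a bounded set, the covers provided by an exponent a < s at scale r cost
    a constant times r to the power s - a. *)
Lemma hcontent_assouad_exponent (s a : R) A : 0 < s -> 0 <= a -> a < s ->
  A `<=` @cube R n -> assouad_exponent eucl_dist A a ->
  hcontent eucl_dist s A = 0%E.
Proof.
move=> s0 a0 as_ Ac [C C0 AC].
have [[x Ax]|/set0P/negP/negPn/eqP ->] := pselect (A !=set0); last first.
  exact: hcontent0.
apply/eqP; rewrite eq_le hcontent_ge0 andbT; apply/lee_addgt0Pr => e e0.
rewrite add0e; pose rho : R := 2 * n%:R + 1.
have rho0 : 0 < rho by rewrite ltr_wpDl// mulr_ge0.
have K0 : 0 < C * rho `^ a by rewrite mulr_gt0// powR_gt0.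
have sa : 0 < s - a by rewrite subr_gt0.
pose r := Num.min (rho / 2) ((e / (C * rho `^ a)) `^ (s - a)^-1).
have r0 : 0 < r by rewrite lt_min divr_gt0//= powR_gt0// divr_gt0.
have [|k [U [kC Ud AU]]] := AC x r rho Ax r0.
  by rewrite gt_min; apply/orP; left; lra.
apply: le_trans (hcontent_fin_union (b := r `^ s) (U := U) s0 _ _) _.
- move=> i; apply: (hcontent_le s0 r0) => y z Uy Uz.
  by rewrite -lee_fin; apply: le_trans (Ud i); exact: diameter_ge.
- move=> y Ay; apply: AU; split => //; rewrite /closed_ball_of /=.
  apply: le_trans (enormD _ _) _; rewrite enormN.
  by have := cube_enorm (Ac _ Ax); have := cube_enorm (Ac _ Ay); rewrite /rho; lra.
rewrite lee_fin; apply: (@le_trans _ _ (C * rho `^ a * r `^ (s - a))).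
  apply: (@le_trans _ _ (C * (rho / r) `^ a * r `^ s)).
    by rewrite ler_wpM2r ?powR_ge0// ltW.
  rewrite powRM ?invr_ge0 ?(ltW rho0) ?(ltW r0)// powRB ?(gt_eqF r0) ?implybT//.
  rewrite -(powR_inv1 (ltW r0)) -powRrM mulN1r powRN.
  by rewrite !mulrA -!mulrA [X in _ * (_ * X)]mulrC.
rewrite mulrC -ler_pdivlMr//.
have <- : ((e / (C * rho `^ a)) `^ (s - a)^-1) `^ (s - a) = e / (C * rho `^ a).
  by rewrite -powRrM mulVf ?gt_eqF// powRr1// ltW// divr_gt0.
apply: ge0_ler_powR; rewrite ?nnegrE ?powR_ge0 ?(ltW r0) ?(ltW sa)//.
by rewrite ge_min lexx orbT.
Qed.

Lemma orth_proj_line u x : enorm u = 1 -> orth_proj <[u]>%VS x = dotp x u *: u.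
Proof.
move=> u1; have uu : dotp u u = 1 by rewrite -enorm_sqr u1 expr1n.
rewrite /orth_proj; set S := [set y | _].
have : S (xget 0 S).
  apply: (xgetPex 0); exists (dotp x u *: u); split.
    by apply/vlineP; exists (dotp x u).
  by move=> v /vlineP[k ->]; rewrite dotpZr dotpBl dotpZl uu mulr1 subrr mulr0.
move=> [/vlineP[k ->] /(_ u (memv_line u))].
by rewrite dotpBl dotpZl uu mulr1 => /eqP; rewrite subr_eq0 => /eqP <-.
Qed.

(** The distance of two lines is at least the distance of the first unit vector
    to its projection on the second line, that is, the sine of the angle. *)
Lemma line_dist_le u v : enorm u = 1 -> enorm v = 1 -> 0 <= dotp u v ->
  eucl_dist u v <= 2 * grass_dist <[u]>%VS <[v]>%VS.
Proof.
move=> u1 v1 uv0.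
have h : enorm (u - dotp u v *: v) <= grass_dist <[u]>%VS <[v]>%VS.
  apply: ub_le_sup.
    exists 2 => _ [x /= x1 <-]; rewrite !orth_proj_line//.
    apply: le_trans (enormD _ _) _; rewrite enormN !enormZ u1 v1 !mulr1.
    have := dotp_norm_le x u; have := dotp_norm_le x v; rewrite u1 v1 !mulr1; lra.
  exists u; first by rewrite /= u1.
  by rewrite !orth_proj_line// -enorm_sqr u1 expr1n scale1r.
apply: le_trans (ler_wpM2l _ h) => //.
rewrite -(@ler_pXn2r _ 2)// ?nnegrE ?mulr_ge0 ?enorm_ge0// exprMn !enorm_sqr.
have uu : dotp u u = 1 by rewrite -enorm_sqr u1 expr1n.
have vv : dotp v v = 1 by rewrite -enorm_sqr v1 expr1n.
have c1 : dotp u v <= 1 by have := dotp_le u v; rewrite u1 v1 mulr1.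
rewrite !dotpBl !dotpBr !dotpZl !dotpZr uu vv (dotpC v u).
by set c := dotp u v in uv0 c1 *; nra.
Qed.

(** Unit vectors that span nearby lines are close to each other up to sign. Hence
    the vectors that span the lines in a small set form two small sets,
    distinguished by the sign of the inner product with one of them. *)
Lemma hcontent_lines (q : R) G : 0 < q -> (forall u, G u -> enorm u = 1) ->
  small_covers grass_dist q [set <[u]>%VS | u in G] ->
  hcontent eucl_dist q G = 0%E.
Proof.
move=> q0 G1 cG; apply/eqP; rewrite eq_le hcontent_ge0 andbT.
apply/lee_addgt0Pr => e e0; rewrite add0e.
have K0 : 0 < 2 * 4 `^ q :> R by rewrite mulr_gt0// powR_gt0.
have [U [r [r0 Ur GU re]]] := cG _ (divr_gt0 e0 K0).
pose G' i := [set u | G u /\ U i <[u]>%VS].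
apply: (@le_trans _ _ (hcontent eucl_dist q (\bigcup_i G' i))).
  apply: le_hcontent => u Gu; have [i _ Ui] := GU _ (imageP _ Gu).
  by exists i.
apply: le_trans (hcontent_bigcup _) _.
apply: (@le_trans _ _ ((2 * 4 `^ q)%:E * \sum_(0 <= i <oo) (r i `^ q)%:E)%E).
  rewrite -nneseriesZl; last by move=> i _; rewrite lee_fin powR_ge0.
  apply: lee_nneseries => [i _ _|i _]; first exact: hcontent_ge0.
  have [[w [Gw Uw]]|/set0P/negP/negPn/eqP ->] := pselect (G' i !=set0); last first.
    by rewrite hcontent0// mule_ge0// lee_fin ?powR_ge0// ltW.
  pose H (b : bool) := [set u | G' i u /\ 0 <= dotp u ((-1) ^+ b *: w)].
  have Hle b : (hcontent eucl_dist q (H b) <= (4 `^ q * r i `^ q)%:E)%E.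
    rewrite -powRM ?(ltW (r0 i))//; apply: hcontent_le => //.
      by rewrite mulr_gt0.
    pose w' := (-1) ^+ b *: w.
    have w'1 : enorm w' = 1 by rewrite enormZ normrX normrN1 expr1n mul1r G1.
    have w'w : <[w']>%VS = <[w]>%VS.
      apply/eqP; rewrite eqEsubv -!memvE; apply/andP; split.
        by rewrite memvZ// memv_line.
      have -> : w = (-1) ^+ b *: w' by rewrite scalerA -expr2 sqrr_sign scale1r.
      by rewrite memvZ// memv_line.
    have Hw u : H b u -> eucl_dist u w' <= 2 * r i.
      move=> [[Gu Uu] uw]; apply: le_trans (line_dist_le (G1 _ Gu) w'1 uw) _.
      by rewrite ler_pM2l// w'w; exact: Ur.
    move=> u v /Hw uw /Hw vw; apply: le_trans (eucl_dist_triangle _ w' _) _.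
    by rewrite (eucl_distC w'); lra.
  apply: (@le_trans _ _ (hcontent eucl_dist q (H false `|` H true))).
    apply: le_hcontent => u Gu; have [uw|uw] := leP 0 (dotp u w).
      by left; split => //; rewrite expr0 scale1r.
    by right; split => //; rewrite expr1 scaleN1r dotpC dotpNl dotpC oppr_ge0 ltW.
  apply: le_trans (hcontent_setU q0 _ _) _.
  apply: le_trans (leeD (Hle _) (Hle _)) _.
  by rewrite -EFinD -EFinM lee_fin; lra.
by rewrite muleC -lee_pdivlMr.
Qed.

End NullSets.

(** * Polar coordinates and pinned distances *)

Section DistanceSets.
Context {R : realType} {n : nat} (N : 'rV[R]_n -> R).
Hypothesis hN : is_norm N.
Implicit Types (E F P W : set 'rV[R]_n) (x y z u v : 'rV[R]_n).

Definition pinned_distances x E : set R := [set N (y - x) | y in E].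

Definition directions x E : set 'rV[R]_n :=
  [set (N (y - x))^-1 *: (y - x) | y in E `\ x].

Lemma directions_norm1 x E u : directions x E u -> N u = 1.
Proof.
move=> [y [_ /eqP yx] <-].
have p : 0 < N (y - x) by apply: is_norm_gt0 => //; rewrite subr_eq0.
by rewrite is_norm_scale// gtr0_norm ?invr_gt0// mulVf// gt_eqF.
Qed.

(** In polar coordinates centred at x, the set E is contained in the product of
    its directions and its distances; the dimension of a product is at most the
    Hausdorff dimension of one factor plus the Assouad dimension of the other. *)
Lemma hcontent_polar (s q a : R) x E : 0 < q -> 0 <= a -> q + a <= s ->
  E x -> E `<=` @cube R n -> assouad_exponent rdist (pinned_distances x E) a ->
  hcontent eucl_dist q (directions x E) = 0%E -> hcontent eucl_dist s E = 0%E.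
Proof.
move=> q0 a0 qas Ex Ec [C C0 DC] /(hcontent_eq0P _ q0) cT.
have s0 : 0 < s by lra.
have [CN CN0 NC] := is_norm_le hN.
pose L : R := CN * (2 * n%:R) + 1.
have n0 : 0 <= n%:R :> R by exact: ler0n.
have L1 : 1 <= L by rewrite lerDr mulr_ge0 ?mulr_ge0// ltW.
have L0 : 0 < L by lra.
have diamE y : E y -> enorm (y - x) <= 2 * n%:R.
  move=> Ey; apply: le_trans (enormD _ _) _; rewrite enormN.
  by have := cube_enorm (Ec _ Ey); have := cube_enorm (Ec _ Ex); lra.
have NL y : E y -> N (y - x) <= L.
  move=> Ey; apply: le_trans (NC _) _; have := diamE y Ey.
  by rewrite -(ler_pM2l CN0) /L; lra.
(* Away from x, the directions have bounded Euclidean norm. *)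
pose A k := if k is j.+1 then [set y | E y /\ j.+1%:R^-1 <= N (y - x)] else [set x].
have EA : E `<=` \bigcup_k A k.
  move=> y Ey; have [->|yx] := eqVneq y x; first by exists 0%N.
  have p : 0 < N (y - x) by apply: is_norm_gt0 => //; rewrite subr_eq0.
  exists (Num.bound (N (y - x))^-1).+1 => //; split => //.
  rewrite -[leRHS]invrK lef_pV2 ?posrE ?invr_gt0//.
  apply: (@le_trans _ _ (Num.bound (N (y - x))^-1)%:R); last by rewrite ler_nat.
  by apply/ltW/archi_boundP; rewrite invr_ge0 ltW.
apply/eqP; rewrite eq_le hcontent_ge0 andbT.
apply: le_trans (le_hcontent EA) _.
rewrite hcontent_null_bigcup// => -[|j] /=.
  apply/eqP; rewrite eq_le hcontent_ge0 andbT.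
  apply: le_trans (hcontent_gauge _ s0 _) _; apply: (le0_powR s0) => r r0.
  by apply: gauge_le => // y z -> ->; rewrite eucl_distxx ltW.
pose B : R := j.+1%:R * (2 * n%:R).
have B0 : 0 <= B by rewrite mulr_ge0 ?mulr_ge0.
pose M := B + L; have M0 : 0 < M by rewrite /M ltr_wpDl.
pose rho := L + 1.
pose K := C * rho `^ a * M `^ s.
have rho_gt0 : 0 < rho by rewrite /rho; lra.
have K0 : 0 < K by rewrite !mulr_gt0 ?powR_gt0.
apply/eqP; rewrite eq_le hcontent_ge0 andbT; apply/lee_addgt0Pr => e e0.
rewrite add0e.
have [|U [r [r0 Ur TU re]]] := cT (Num.min 1 (e / K)).
  by rewrite lt_min ltr01 divr_gt0.
have r1 i : r i <= 1.
  have := nneseries_term i (fun k => powR_ge0 (r k) q) re.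
  rewrite le_min => /andP[rq _]; rewrite leNgt; apply/negP.
  by move=> /(gt0_ltr_powR q0); rewrite !nnegrE powR1 ltNge rq; move=> /(_ ler01 (ltW (r0 i))).
pose Y i := [set y | A j.+1 y /\ U i ((N (y - x))^-1 *: (y - x))].
have Npos y : A j.+1 y -> 0 < N (y - x).
  by move=> [_]; apply: lt_le_trans; rewrite invr_gt0.
apply: (@le_trans _ _ (hcontent eucl_dist s (\bigcup_i Y i))).
  apply: le_hcontent => y Ay; have Ny := Npos y Ay.
  have [|i _ Ui] := TU ((N (y - x))^-1 *: (y - x)); last by exists i.
  exists y => //; split; first by case: Ay.
  by move=> /= yx; move: Ny; rewrite yx subrr is_norm0// ltxx.
apply: le_trans (hcontent_bigcup _) _.
have Yle i : (hcontent eucl_dist s (Y i) <= (K * r i `^ q)%:E)%E.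
  have D0 : pinned_distances x E 0 by exists x => //; rewrite subrr is_norm0.
  have [|k [V [kC Vd DV]]] := DC 0 (r i) rho D0 (r0 i).
    by rewrite /rho; have := r1 i; lra.
  pose Z (l : 'I_k) := [set y | Y i y /\ V l (N (y - x))].
  apply: le_trans (hcontent_fin_union (b := (M * r i) `^ s) (U := Z) s0 _ _) _.
  - move=> l; apply: hcontent_le => //; first by rewrite mulr_gt0.
    move=> y z [[Ay Uy] Vy] [[Az Uz] Vz].
    set u := _ *: (y - x) in Uy; set w := _ *: (z - x) in Uz.
    have yE : y - x = N (y - x) *: u by rewrite scalerA divff ?scale1r// gt_eqF// Npos.
    have zE : z - x = N (z - x) *: w by rewrite scalerA divff ?scale1r// gt_eqF// Npos.
    have uB : enorm u <= B.
      rewrite enormZ gtr0_norm ?invr_gt0 ?Npos//.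
      apply: ler_pM => //; rewrite ?invr_ge0 ?(ltW (Npos _ Ay)) ?enorm_ge0//.
        rewrite -[leRHS]invrK lef_pV2 ?posrE ?invr_gt0//; first by case: Ay.
        exact: Npos.
      by apply: diamE; case: Ay.
    have E1 : y - z = (N (y - x) - N (z - x)) *: u + N (z - x) *: (u - w).
      by rewrite scalerBl scalerBr addrA subrK -yE -zE opprB addrA subrK.
    rewrite /eucl_dist E1; apply: le_trans (enormD _ _) _.
    rewrite (enormZ _ u) (enormZ _ (u - w)).
    have dN : `|N (y - x) - N (z - x)| <= r i.
      by rewrite -lee_fin; apply: le_trans (Vd l); exact: (@diameter_ge _ _ rdist).
    have uw : enorm (u - w) <= r i by exact: Ur.
    rewrite (gtr0_norm (Npos _ Az)) /M mulrDl [B * _]mulrC; apply: lerD.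
      by apply: ler_pM => //; exact: enorm_ge0.
    apply: ler_pM => //; [exact/ltW/Npos|exact: enorm_ge0|].
    by apply: NL; case: Az.
  - move=> y Yy; have [[Ey _] _] := Yy.
    have [|l _ Vl] := DV (N (y - x)); last by exists l.
    split; first by exists y.
    rewrite /closed_ball_of /= /rdist sub0r normrN ger0_norm ?is_norm_ge0//.
    by have := NL _ Ey; rewrite /rho; lra.
  rewrite lee_fin.
  apply: (@le_trans _ _ (C * (rho / r i) `^ a * (M * r i) `^ s)).
    by rewrite ler_wpM2r ?powR_ge0// ltW.
  have rho0 : 0 <= rho by rewrite /rho; lra.
  have ri0 : 0 <= r i by exact: ltW.
  have E2 : (rho / r i) `^ a * (M * r i) `^ s = rho `^ a * M `^ s * r i `^ (s - a).
    rewrite powRM ?invr_ge0// (powRM _ (ltW M0))//.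
    rewrite powRB ?(gt_eqF (r0 i)) ?implybT// -(powR_inv1 ri0) -powRrM mulN1r powRN.
    ring.
  rewrite -mulrA E2 !mulrA -/K ler_pM2l//.
  by apply: ger_powR; [rewrite r0 r1|lra].
apply: (@le_trans _ _ (K%:E * \sum_(0 <= i <oo) (r i `^ q)%:E)%E).
  rewrite -nneseriesZl; last by move=> i _; rewrite lee_fin powR_ge0.
  apply: lee_nneseries => [i _ _|i _]; first exact: hcontent_ge0.
  by rewrite -EFinM.
rewrite muleC -lee_pdivlMr//; apply: le_trans re _.
by rewrite -EFinM lee_fin ge_min lexx orbT.
Qed.

(** Differences of norms are at most the norm of the difference, so a copy of a
    finite part of E together with x in F reproduces the distances from x. *)
Lemma pinned_distances_approximable x E F : E x -> affinely_tangent E F ->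
  approximable rdist rdist (pinned_distances x E) (distance_set N F).
Proof.
move=> Ex EF k p e Dp e0; have [C C0 NC] := is_norm_le hN.
have /choice[y yP] : forall i, exists y, E y /\ N (y - x) = p i.
  by move=> i; have [y Ey <-] := Dp i; exists y.
pose y' (i : 'I_k.+1) := if unlift ord_max i is Some j then y j else x.
have e1 : 0 < e / (4 * C) by rewrite divr_gt0// mulr_gt0.
have [|z [l [b [l0 bP]]]] := EF _ y' _ e1.
  by move=> i; rewrite /y'; case: unliftP => // j _; case: (yP j).
pose X := b ord_max; pose Q i := b (lift ord_max i).
have XP : F X /\ enorm (z + l *: x - X) <= l * (e / (4 * C)).
  by have := bP ord_max; rewrite /y' unlift_none.
have QP i : F (Q i) /\ enorm (z + l *: y i - Q i) <= l * (e / (4 * C)).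
  by have := bP (lift ord_max i); rewrite /y' liftK.
have main i : `|N (Q i - X) - l * p i| <= l * (e / 2).
  have -> : l * p i = N (l *: (y i - x)).
    by rewrite is_norm_scale// gtr0_norm// (yP i).2.
  apply: le_trans (is_norm_dist hN _ _) _; apply: le_trans (NC _) _.
  have -> : Q i - X - l *: (y i - x) = (z + l *: x - X) - (z + l *: y i - Q i).
    by apply/rowP => j; rewrite !mxE; ring.
  apply: (@le_trans _ _ (C * (2 * (l * (e / (4 * C)))))).
    rewrite ler_pM2l//; apply: le_trans (enormD _ _) _; rewrite enormN.
    by have := XP.2; have := (QP i).2; lra.
  by rewrite le_eqVlt; apply/orP; left; apply/eqP; field; rewrite gt_eqF.
exists (fun i => N (Q i - X)), l; split => // [i|i j].
  by exists (Q i, X) => //; split => //=; [case: (QP i)|case: XP].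
rewrite /rdist -[l in l * _](gtr0_norm l0) -normrM mulrBr.
apply: le_trans (ler_dist_dist _ _) _.
have -> : N (Q i - X) - N (Q j - X) - (l * p i - l * p j) =
          (N (Q i - X) - l * p i) - (N (Q j - X) - l * p j) by ring.
apply: le_trans (ler_normB _ _) _; have := main i; have := main j.
lra.
Qed.

End DistanceSets.

(** * Distances near a pair of points *)

Section Projections.
Context {R : realType} {n : nat}.
Implicit Types (E F P W : set 'rV[R]_n) (x y z u v : 'rV[R]_n).

(** Up to errors that are small relative to the scales l and m, the set F contains
    a copy at scale l of the pair x, y, and close to the image of y a copy at
    scale m of a finite part of P. *)
Definition copies_at_pairs E P F := forall x y k (p : 'I_k -> 'rV[R]_n) (e : R),
  E x -> E y -> (forall i, P (p i)) -> 0 < e ->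
  exists (l m : R) X (Q : 'I_k -> 'rV[R]_n),
    [/\ 0 < l /\ 0 < m, F X, forall i, F (Q i),
        forall i, enorm (Q i - X - l *: (y - x)) <= l * e &
        forall i j, enorm (Q i - Q j - m *: (p i - p j)) <= m * e].

(** The configurations found in the weak tangent W of F are finite, so they can be
    reproduced in F, with an error that is negligible at the smallest scale. *)
Lemma tangents_with_copies (s : R) F : 0 < s ->
  (forall t : R, 0 <= t -> t < s -> ~ assouad_exponent eucl_dist F t) ->
  exists E P : set 'rV[R]_n,
    [/\ hcontent eucl_dist s E != 0%E /\ E `<=` @cube R n,
        hcontent eucl_dist s P != 0%E /\ P `<=` @cube R n,
        affinely_tangent E F, affinely_tangent P F &
        copies_at_pairs E P F].
Proof.
move=> s0 Fs; have [W [WF W0]] := exists_thick_tangent s0 Fs.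
have [E [P [E0 P0 EW PW copies]]] := common_microtangent s0 W0.
exists E, P; split => //; [exact: affinely_tangent_trans WF..|].
move=> x y k p e Ex Ey Pp e0.
have n0 : 0 <= n%:R :> R by exact: ler0n.
pose d := Num.min 1 (e / (4 + n%:R + 1)).
have d0 : 0 < d by rewrite lt_min ltr01 divr_gt0//; lra.
have d1 : d <= 1 by rewrite ge_min lexx.
have de : d * (4 + n%:R + 1) <= e.
  rewrite -ler_pdivlMr; last by lra.
  by rewrite ge_min lexx orbT.
have [z [l [x' [z' [l' [q [[l0 l'0 l'l] [Wx' xx' yz' qP]]]]]]]] :=
  copies x y k p d Ex Ey Pp d0.
pose w (i : 'I_k.+1) := if unlift ord_max i is Some j then q j else x'.
have [|t [c [b [c0 bP]]]] := WF _ w (l' * d) (mulr_gt0 l'0 d0).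
  by move=> i; rewrite /w; case: unliftP => // j _; case: (qP j).
pose X := b ord_max; pose Q i := b (lift ord_max i).
have [FX hX] : F X /\ enorm (t + c *: x' - X) <= c * (l' * d).
  by have := bP ord_max; rewrite /w unlift_none.
have QP i : F (Q i) /\ enorm (t + c *: q i - Q i) <= c * (l' * d).
  by have := bP (lift ord_max i); rewrite /w liftK.
exists (c * l), (c * l'), X, Q; split => //.
- by rewrite !mulr_gt0.
- by move=> i; case: (QP i).
- move=> i; have [_ hQ] := QP i; have [_ hq] := qP i.
  have -> : Q i - X - (c * l) *: (y - x) =
      (t + c *: x' - X) - (t + c *: q i - Q i) +
      c *: (l' *: p i - (z' + l' *: p i - q i)
            - (z + l *: y - z') + (z + l *: x - x')).
    by apply/rowP => j; rewrite !mxE; ring.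
  apply: (@le_trans _ _ (c * (l' * d) + c * (l' * d) +
     c * (l' * n%:R + l' * d + l * d + l * d))).
    apply: le_trans (enormD _ _) _; apply: lerD.
      by apply: le_trans (enormD _ _) _; rewrite enormN; apply: lerD.
    rewrite enormZ (gtr0_norm c0) ler_pM2l//.
    apply: le_trans (enormD _ _) _; apply: lerD => //.
    apply: le_trans (enormD _ _) _; rewrite enormN; apply: lerD => //.
    apply: le_trans (enormD _ _) _; rewrite enormN; apply: lerD => //.
    rewrite enormZ (gtr0_norm l'0) ler_pM2l//.
    by apply: cube_enorm; exact: P0.2.
  rewrite -!mulrDr -mulrA ler_pM2l//.
  have l'd : l' * d <= l * d.
    rewrite ler_pM2r//; apply: le_trans l'l _.
    by rewrite ler_piMr// ltW.
  have : l' * n%:R <= l * d * n%:R by rewrite ler_wpM2r.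
  have : l * (d * (4 + n%:R + 1)) <= l * e by rewrite ler_pM2l.
  have : 0 <= l * d by rewrite mulr_ge0// ltW.
  by lra.
- move=> i j; have [_ hQi] := QP i; have [_ hqi] := qP i.
  have [_ hQj] := QP j; have [_ hqj] := qP j.
  have -> : Q i - Q j - (c * l') *: (p i - p j) =
      (t + c *: q j - Q j) - (t + c *: q i - Q i) +
      c *: ((z' + l' *: p j - q j) - (z' + l' *: p i - q i)).
    by apply/rowP => h; rewrite !mxE; ring.
  apply: (@le_trans _ _ (c * (l' * d) + c * (l' * d) + c * (l' * d + l' * d))).
    apply: le_trans (enormD _ _) _; apply: lerD.
      by apply: le_trans (enormD _ _) _; rewrite enormN; apply: lerD.
    rewrite enormZ (gtr0_norm c0) ler_pM2l//.
    by apply: le_trans (enormD _ _) _; rewrite enormN; apply: lerD.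
  have cl0 : 0 < c * l' by exact: mulr_gt0.
  have -> : c * (l' * d) + c * (l' * d) + c * (l' * d + l' * d) = c * l' * (4 * d).
    by ring.
  rewrite ler_pM2l//; apply: le_trans de.
  by rewrite mulrC ler_pM2l//; lra.
Qed.

(** By strict differentiability of N at y - x, the differences of the distances
    from X to the points Q i are those of the values of the gradient, which
    measures the projection to the line spanned by nu. *)
Lemma projection_approximable (N : 'rV[R]_n -> R) (hN : is_norm N) E P F x y nu (k : R) :
  copies_at_pairs E P F -> P `<=` @cube R n -> E x -> E y -> y != x ->
  enorm nu = 1 -> k != 0 -> has_gradient N ((N (y - x))^-1 *: (y - x)) (k *: nu) ->
  approximable eucl_dist rdist (orth_proj <[nu]>%VS @` P) (distance_set N F).
Proof.
move=> copies Pc Ex Ey yx nu1 k0 grad r p e Pp e0.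
have /choice[p' p'P] : forall i, exists p', P p' /\ orth_proj <[nu]>%VS p' = p i.
  by move=> i; have [p' ? ?] := Pp i; exists p'.
have k1 : 0 < `|k| by rewrite normr_gt0.
have n0 : 0 <= n%:R :> R by exact: ler0n.
have w0 : y - x != 0 by rewrite subr_eq0.
(* The points Q i lie within 2 * m * (n + 1) of each other, so that the error of
   strict differentiability is at most m * |k| * e / 2. *)
pose c := `|k| * e / (4 * (n%:R + 1)).
have c0 : 0 < c by rewrite divr_gt0 ?mulr_gt0//; lra.
have Ne : N ((N (y - x))^-1 *: (y - x)) = 1.
  have p0 := is_norm_gt0 hN w0.
  by rewrite is_norm_scale// gtr0_norm ?invr_gt0// mulVf// gt_eqF.
have [d d0 dP] := gradient_strict hN Ne grad w0 erefl c0.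
pose t := Num.min 1 (Num.min (e / 2) (d / 2)).
have t0 : 0 < t by rewrite !lt_min ltr01 !divr_gt0.
have t1 : t <= 1 by rewrite ge_min lexx.
have te : t <= e / 2 by rewrite !ge_min lexx !orbT.
have td : t < d by apply: (@le_lt_trans _ _ (d / 2)); [rewrite !ge_min lexx !orbT|lra].
have [l [m [X [Q [[l0 m0] FX FQ Qw QQ]]]]] :=
  copies x y r p' t Ex Ey (fun i => (p'P i).1) t0.
exists (fun i => N (Q i - X)), (m * `|k|); split.
- exact: mulr_gt0.
- by move=> i; exists (Q i, X) => //; split => //=; exact: FQ.
move=> i j; pose u i := l^-1 *: (Q i - X).
have uE i' : Q i' - X = l *: u i' by rewrite scalerA divff ?scale1r// gt_eqF.
have ud i' : enorm (u i' - (y - x)) < d.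
  apply: le_lt_trans td; rewrite -(ler_pM2l l0) -[l in leLHS]gtr0_norm// -enormZ.
  by rewrite scalerBr -uE.
have QE : Q i - Q j = l *: (u i - u j).
  by rewrite scalerBr -!uE opprB addrA subrK.
have H1 : `|N (Q i - X) - N (Q j - X) - k * dotp nu (Q i - Q j)| <=
          c * enorm (Q i - Q j).
  have NE i' : N (Q i' - X) = l * N (u i').
    by rewrite uE (is_norm_scale hN) (gtr0_norm l0).
  rewrite QE !NE (enormZ l (u i - u j)) (gtr0_norm l0).
  have -> : l * N (u i) - l * N (u j) - k * dotp nu (l *: (u i - u j)) =
            l * (N (u i) - N (u j) - dotp (k *: nu) (u i - u j)).
    by rewrite dotpZr dotpZl; ring.
  by rewrite normrM (gtr0_norm l0) mulrCA ler_pM2l// dP.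
have H2 : enorm (Q i - Q j) <= m * (2 * (n%:R + 1)).
  have -> : Q i - Q j = (Q i - Q j - m *: (p' i - p' j)) + m *: (p' i - p' j).
    by rewrite subrK.
  apply: le_trans (enormD _ _) _; rewrite enormZ (gtr0_norm m0).
  have pp : enorm (p' i - p' j) <= 2 * n%:R.
    apply: le_trans (enormD _ _) _; rewrite enormN.
    have := cube_enorm (Pc _ (p'P i).1); have := cube_enorm (Pc _ (p'P j).1); lra.
  have := QQ i j; have := ler_wpM2l (ltW m0) pp.
  have := ler_wpM2l (ltW m0) t1; lra.
have H3 : `|k * dotp nu (Q i - Q j) - m * (k * dotp nu (p' i - p' j))| <=
          `|k| * (m * (e / 2)).
  have -> : k * dotp nu (Q i - Q j) - m * (k * dotp nu (p' i - p' j)) =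
            k * dotp nu (Q i - Q j - m *: (p' i - p' j)).
    by rewrite (dotpBr _ (m *: _)) dotpZr; ring.
  rewrite normrM ler_pM2l//; apply: le_trans (dotp_norm_le _ _) _.
  rewrite nu1 mul1r; apply: le_trans (QQ i j) _.
  by rewrite ler_pM2l.
have pE : m * `|k| * eucl_dist (p i) (p j) = `|m * (k * dotp nu (p' i - p' j))|.
  rewrite /eucl_dist -(p'P i).2 -(p'P j).2 !orth_proj_line// -scalerBl -dotpBl.
  by rewrite enormZ nu1 mulr1 (dotpC nu) !normrM (gtr0_norm m0) mulrA.
rewrite pE /rdist; apply: le_trans (ler_dist_dist _ _) _.
set A := N (Q i - X) - N (Q j - X) in H1 *; set B := k * dotp nu (Q i - Q j) in H1 H3.
have -> : A - m * (k * dotp nu (p' i - p' j)) =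
          (A - B) + (B - m * (k * dotp nu (p' i - p' j))) by ring.
apply: le_trans (ler_normD _ _) _.
apply: (@le_trans _ _ (c * (m * (2 * (n%:R + 1))) + `|k| * (m * (e / 2)))).
  apply: lerD => //; apply: le_trans H1 _.
  by rewrite ler_pM2l.
rewrite le_eqVlt; apply/orP; left; apply/eqP.
by rewrite /c; field; lra.
Qed.

End Projections.

(** * The dimension of the distance set *)

Lemma assouad_dim_ge0 (R : realType) (T : Type) (d : T -> T -> R) (F : set T) :
  (0 <= assouad_dim d F)%E.
Proof. by apply: le_ereal_inf_tmp => _ [a [a0 _] <-]; rewrite lee_fin. Qed.

Lemma hausdorff_dim_ge0 (R : realType) (T : Type) (d : T -> T -> R) (F : set T) :
  (0 <= hausdorff_dim d F)%E.
Proof. by apply: le_ereal_inf_tmp => _ [a [a0 _] <-]; rewrite lee_fin. Qed.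

Lemma small_covers_of_dim (R : realType) (T : Type) (d : T -> T -> R) (q : R)
  (F : set T) : (hausdorff_dim d F < q%:E)%E -> small_covers d q F.
Proof.
move=> /ereal_inf_lt[_ [s [s0 Hs] <-]]; rewrite lte_fin => sq.
exact: small_covers_of_hausdorff Hs.
Qed.

Lemma assouad_dim_lt (R : realType) (T : Type) (d : T -> T -> R) (q : \bar R)
  (F : set T) : (assouad_dim d F < q)%E ->
  exists a : R, [/\ 0 <= a, (a%:E < q)%E & assouad_exponent d F a].
Proof. by move=> /ereal_inf_lt[_ [a [a0 Fa] <-] aq]; exists a. Qed.

Lemma assouad_dim_le (R : realType) (T : Type) (d : T -> T -> R) (a : R)
  (F : set T) : 0 <= a -> assouad_exponent d F a -> (assouad_dim d F <= a%:E)%E.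
Proof. by move=> a0 Fa; apply: ereal_inf_lbound; exists a. Qed.

Theorem mainTheorem8 (R : realType) (n : nat) (hn : (2 <= n)%N)
    (N : 'rV[R]_n -> R) (hN : is_norm N)
    (hC1 : C1_hypersurface (boundary (unit_ball N)))
    (hgauss : forall E : set 'rV[R]_n, E `<=` boundary (unit_ball N) ->
       (hausdorff_dim eucl_dist E
          <= hausdorff_dim eucl_dist (gauss_map (unit_ball N) @` E))%E)
    (F : set 'rV[R]_n) (hF : F !=set0) :
  (Order.min (assouad_dim eucl_dist F - theta (assouad_dim eucl_dist F) n 1) 1
     <= assouad_dim rdist (distance_set N F))%E.
Proof.
rewrite leNgt; apply/negP => /assouad_dim_lt[a [a0]].
have [t0 t00 /(assouad_dim_le t00) dimF_le] := assouad_exponent_exists F.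
set S := assouad_dim eucl_dist F in dimF_le *.
have S0 : (0 <= S)%E by exact: assouad_dim_ge0.
have Sfin : S \is a fin_num by rewrite ge0_fin_numE// (le_lt_trans dimF_le)// ltry.
pose s := fine S; have SE : S = s%:E by rewrite fineK.
have theta0 : (0 <= theta S n 1)%E.
  apply: le_trans (ereal_sup_ubound _); last by exists F.
  exact: hausdorff_dim_ge0.
rewrite lt_min => /andP[aS a1] Da.
have theta_fin : theta S n 1 \is a fin_num.
  rewrite ge0_fin_numE// ltey; apply/eqP => E; move: aS.
  by rewrite E SE.
pose th := fine (theta S n 1).
have thE : theta S n 1 = th%:E by rewrite fineK.
have th0 : 0 <= th by rewrite fine_ge0.
move: aS; rewrite thE SE -EFinB !lte_fin in a1 * => aS.
have s0 : 0 < s by lra.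
(* Two dimensions between theta and s - a leave room for strict inequalities. *)
pose q := (th + (s - a)) / 2; pose q' := (q + (s - a)) / 2.
have [thq qq' q's] : [/\ th < q, q < q' & q' + a <= s] by rewrite /q' /q; split; lra.
have q0 : 0 < q by lra.
have q'0 : 0 < q' by lra.
have Fs t : 0 <= t -> t < s -> ~ assouad_exponent eucl_dist F t.
  move=> t0_ ts /(assouad_dim_le t0_); rewrite -/S SE lee_fin; lra.
have [E [P [[E0 Ec] [P0 Pc] EF PF copies]]] := tangents_with_copies s0 Fs.
have dimP : assouad_dim eucl_dist P = S.
  apply/eqP; rewrite eq_le; apply/andP; split.
    apply: le_ereal_inf_tmp => _ [b [b0 Fb] <-]; apply: assouad_dim_le => //.
    apply: (assouad_exponent_approximable _ _ b0 _ Fb).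
    - exact: eucl_distC.
    - exact: eucl_dist_triangle.
    - exact: affinely_tangent_approximable.
  rewrite SE; apply: le_ereal_inf_tmp => _ [b [b0 Pb] <-]; rewrite lee_fin leNgt.
  by apply: contraNN P0 => bs; apply/eqP; exact: (hcontent_assouad_exponent s0 b0 bs).
have [x Ex] : E !=set0.
  by apply/set0P; apply: contraNneq E0 => ->; rewrite hcontent0.
pose T := directions N x E.
have T1 : T `<=` boundary (unit_ball N).
  by move=> e /(directions_norm1 hN) ?; exact/boundary_unit_ball.
pose G := gauss_map (unit_ball N) @` T.
have G1 u : G u -> enorm u = 1.
  move=> [e /(directions_norm1 hN) Ne <-].
  by case: (gauss_map_gradient hN Ne hC1).
have exc u : G u -> exceptional_set 1 P <[u]>%VS.
  move=> Gu; have u1 := G1 u Gu; split.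
    rewrite /grassmannian /= dim_vline; case: eqVneq => // u0.
    by move: u1; rewrite u0 enorm0 => /esym/eqP; rewrite oner_eq0.
  rewrite dimP SE; apply: (@le_lt_trans _ _ a%:E); last first.
    by rewrite lt_min !lte_fin; apply/andP; split; lra.
  move: Gu => [e [y [Ey /eqP yx] <-] uE].
  have Ne : N ((N (y - x))^-1 *: (y - x)) = 1.
    by apply: (directions_norm1 hN (x := x) (E := E)); exists y => //; split => //; exact/eqP.
  have [_ [k k0]] := gauss_map_gradient hN Ne hC1; rewrite uE => grad.
  apply: assouad_dim_le => //.
  apply: (assouad_exponent_approximable _ _ a0 _ Da).
  - exact: eucl_distC.
  - exact: eucl_dist_triangle.
  - exact: projection_approximable copies Pc Ex Ey yx u1 k0 grad.
have G0 : hcontent eucl_dist q G = 0%E.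
  apply: hcontent_lines => // e e0.
  have [|U [r [r0 Ur excU re]]] := @small_covers_of_dim _ _ grass_dist q
      (exceptional_set 1 P) _ e e0.
    apply: (@le_lt_trans _ _ th%:E); last by rewrite lte_fin.
    by rewrite -thE; apply: ereal_sup_ubound; exists P.
  by exists U, r; split => // _ [u Gu <-]; apply/excU/exc.
have T0 : hcontent eucl_dist q' T = 0%E.
  apply/hcontent_eq0P => //; apply: small_covers_of_dim.
  apply: le_lt_trans (hgauss T T1) _; apply: (@le_lt_trans _ _ q%:E).
    apply: ereal_inf_lbound; exists q => //; split; first exact: ltW.
    by apply: hausdorff_of_small_covers => //; exact/hcontent_eq0P.
  by rewrite lte_fin.
move/negP: E0; apply; apply/eqP.
apply: (hcontent_polar hN q'0 a0 q's Ex Ec _ T0).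
apply: (assouad_exponent_approximable _ _ a0 _ Da).
- by move=> b c; rewrite /rdist distrC.
- by move=> b c d; rewrite /rdist; exact: ler_distD.
- exact: pinned_distances_approximable.
Qed.
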